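(* Let $\mathfrak{A}$ be a commutative $C^*$-algebra. Then for every Hilbert $\mathfrak{A}$-module $E$, every positive operator $t\in\mathcal{L}(E)$ and every $x\in E\setminus\{0\}$, the following inequalities hold in $\mathfrak{A}$: $$\langle tx,x\rangle^r\leq\|x\|^{2(r-1)}\langle t^rx,x\rangle\quad\text{for every real } r>1,$$ $$\langle tx,x\rangle^r\geq\|x\|^{2(r-1)}\langle t^rx,x\rangle\quad\text{for every real } r \text{ with } 0<r<1.$$
   Context: Hilbert $C^*$-modules are right modules: a Hilbert $\mathfrak{A}$-module $E$ is a complex vector space and right $\mathfrak{A}$-module with an $\mathfrak{A}$-valued inner product $\langle\cdot,\cdot\rangle$ (linear in the second variable, conjugate-linear in the first, with $\langle x,ya\rangle=\langle x,y\rangle a$, $\langle x,y\rangle^*=\langle y,x\rangle$, $\langle x,x\rangle\ge 0$, and $\langle x,x\rangle=0$ only if $x=0$), complete for the norm $\|x\|=\|\langle x,x\rangle\|^{1/2}$. $\mathcal{L}(E)$ denotes the $C^*$-algebra of all adjointable operators on $E$; a positive operator is a positive element of this $C^*$-algebra. For a positive operator $t$, the element $\langle tx,x\rangle$ is positive in $\mathfrak{A}$; the powers $t^r$ and $\langle tx,x\rangle^r$ are defined by the continuous functional calculus in $\mathcal{L}(E)$ and $\mathfrak{A}$ respectively. For self-adjoint elements $a,b$ of $\mathfrak{A}$, $a\leq b$ means that $b-a$ is positive. The $C^*$-algebra $\mathfrak{A}$ is not assumed to be unital. *)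

(* Defs.v *)
From HB Require Import structures.
From mathcomp Require Import all_boot all_order all_algebra.
From mathcomp Require Import complex.
From mathcomp Require Import all_classical all_reals all_analysis.

Set Implicit Arguments.
Unset Strict Implicit.
Unset Printing Implicit Defensive.

Import Order.TTheory GRing.Theory Num.Theory.
Import numFieldNormedType.Exports.

Local Open Scope classical_set_scope.
Local Open Scope ring_scope.
Local Open Scope complex_scope.

(* Complex *-algebras, not assumed unital (hence not built on MathComp's
   unital rings). *)
HB.mixin Record isStarAlgebra (R : realType) A of GRing.Lmodule R[i] A := {
  amul : A -> A -> A;
  star : A -> A;
  amulA : associative amul;
  amulDl : left_distributive amul +%R;
  amulDr : right_distributive amul +%R;
  amulZl : forall (k : R[i]) (a b : A), amul (k *: a) b = k *: amul a b;
  amulZr : forall (k : R[i]) (a b : A), amul a (k *: b) = k *: amul a b;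
  starK : involutive star;
  starD : forall a b : A, star (a + b) = star a + star b;
  starZ : forall (k : R[i]) (a : A), star (k *: a) = Num.conj k *: star a;
  starM : forall a b : A, star (amul a b) = amul (star b) (star a)
}.

#[short(type="starAlgType")]
HB.structure Definition StarAlgebra (R : realType) :=
  {A of GRing.Lmodule R[i] A & isStarAlgebra R A}.

Infix "**" := amul (at level 40, left associativity) : ring_scope.

HB.mixin Record isCStarAlgebra (R : realType) A
    of CompleteNormedModule R[i] A & isStarAlgebra R A := {
  cstar_normM : forall a b : A, `|a ** b| <= `|a| * `|b|;
  cstar_norm_star : forall a : A, `|star a ** a| = `|a| ^+ 2
}.

#[short(type="cstarAlgType")]
HB.structure Definition CStarAlgebra (R : realType) :=
  {A of CompleteNormedModule R[i] A & isStarAlgebra R A & isCStarAlgebra R A}.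

Section Spectrum.
Context {R : realType} {A : starAlgType R}.
Implicit Types (a b : A) (f g : R[i] -> R[i]).

(* Product of the unitization A + C1; the pair (a, k) stands for a + k1. *)
Definition unitization_mul (u v : A * R[i]) : A * R[i] :=
  (u.1 ** v.1 + u.2 *: v.1 + v.2 *: u.1, u.2 * v.2).

Definition unitization_unit (u : A * R[i]) : Prop :=
  exists v, unitization_mul u v = (0, 1) /\ unitization_mul v u = (0, 1).

(* The spectrum is always taken in the unitization, so that it contains 0. If A
   is already unital this is the usual spectrum with 0 adjoined, which affects
   neither positivity nor the value f(a) for a function f with f(0) = 0. *)
Definition spectrum a : set R[i] :=
  [set z | ~ unitization_unit (a, - z)].

Definition positive a : Prop :=
  star a = a /\ spectrum a `<=` [set z | 0 <= z].

Definition ale a b : Prop := positive (b - a).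

(* The functions to which the functional calculus of a applies: without a unit
   in A they have to vanish at 0. *)
Definition calculus_fun a f : Prop :=
  f 0 = 0 /\
  {within (spectrum a : set R[i]^o), continuous (f : R[i]^o -> R[i]^o)}.

(* phi is the *-homomorphism, from the algebra of continuous functions on the
   spectrum of a vanishing at 0, that maps the identity function to a. It acts
   on total functions, of which only the restriction to the spectrum matters.
   In a C*-algebra such a *-homomorphism is automatically contractive and is
   unique; it exists exactly when a is normal. *)
Definition is_functional_calculus a (phi : (R[i] -> R[i]) -> A) : Prop :=
  [/\ forall f g, calculus_fun a f -> calculus_fun a g ->
        (forall z, spectrum a z -> f z = g z) -> phi f = phi g,
      forall f g, calculus_fun a f -> calculus_fun a g ->
        phi (fun z => f z + g z) = phi f + phi g /\
        phi (fun z => f z * g z) = phi f ** phi g,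
      forall (k : R[i]) f, calculus_fun a f ->
        phi (fun z => k * f z) = k *: phi f,
      forall f, calculus_fun a f ->
        phi (fun z => Num.conj (f z)) = star (phi f) &
      phi id = a].

Definition functional_calculus a : (R[i] -> R[i]) -> A :=
  xget (fun=> 0) [set phi | is_functional_calculus a phi].

(* Real power a^r, r > 0, of a positive element a. *)
Definition apow a (r : R) : A :=
  functional_calculus a (fun z => ((complex.Re z) `^ r)%:C).

End Spectrum.

HB.mixin Record isHilbertModule (R : realType) (A : cstarAlgType R) E
    of CompleteNormedModule R[i] E := {
  ract : E -> A -> E;
  inner : E -> E -> A;
  ractA : forall x a b, ract (ract x a) b = ract x (a ** b);
  ractDl : forall x y a, ract (x + y) a = ract x a + ract y a;
  ractDr : forall x a b, ract x (a + b) = ract x a + ract x b;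
  ractZl : forall (k : R[i]) x a, ract (k *: x) a = k *: ract x a;
  ractZr : forall (k : R[i]) x a, ract x (k *: a) = k *: ract x a;
  innerDr : forall x y z, inner x (y + z) = inner x y + inner x z;
  innerZr : forall (k : R[i]) x y, inner x (k *: y) = k *: inner x y;
  inner_ract : forall x y a, inner x (ract y a) = inner x y ** a;
  inner_star : forall x y, star (inner x y) = inner y x;
  inner_ge0 : forall x, positive (inner x x);
  inner_eq0 : forall x, inner x x = 0 -> x = 0;
  (* The norm for which E is complete is the one given by the inner product. *)
  hilbert_normE : forall x : E, `|x| = sqrtC `|inner x x|
}.

#[short(type="hilbertModType")]
HB.structure Definition HilbertModule (R : realType) (A : cstarAlgType R) :=
  {E of CompleteNormedModule R[i] E & isHilbertModule R A E}.

Section Adjointable.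
Context {R : realType} {A : cstarAlgType R} {E : hilbertModType A}.
Implicit Types (s t u : E -> E) (x y : E).

Definition is_adjoint t s : Prop := forall x y, inner (t x) y = inner x (s y).

(* Maps with an adjoint are automatically C-linear, A-linear and bounded. *)
Definition adjointable_pred : {pred E -> E} :=
  fun t => `[< exists s, is_adjoint t s >].

Record adjointable := Adjointable {
  adjointable_fun :> E -> E;
  adjointable_funP : adjointable_fun \in adjointable_pred
}.

HB.instance Definition _ := [isSub for adjointable_fun].
HB.instance Definition _ := [Choice of adjointable by <:].

Lemma innerDl x y (z : E) : inner (x + y) z = inner x z + inner y z.
Proof. by rewrite -inner_star innerDr starD !inner_star. Qed.

Lemma innerZl (k : R[i]) x y : inner (k *: x) y = Num.conj k *: inner x y.
Proof. by rewrite -inner_star innerZr starZ inner_star. Qed.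

Lemma innerBr x y (z : E) : inner x (y - z) = inner x y - inner x z.
Proof. by rewrite -scaleN1r innerDr innerZr scaleN1r. Qed.

Lemma inner0r x : inner x 0 = 0.
Proof. by rewrite -(subrr (0 : E)) innerBr subrr. Qed.

Lemma inner0l x : inner 0 x = 0.
Proof. by rewrite -(scale0r (0 : E)) innerZl conjC0 scale0r. Qed.

Lemma inner_inj x y : (forall z, inner z x = inner z y) -> x = y.
Proof.
move=> eq_xy; apply/eqP; rewrite -subr_eq0; apply/eqP/inner_eq0.
by rewrite innerBr eq_xy subrr.
Qed.

Lemma is_adjointC t s : is_adjoint t s -> is_adjoint s t.
Proof. by move=> ts x y; rewrite -inner_star -ts inner_star. Qed.

Lemma adjointable_submod : submod_closed adjointable_pred.
Proof.
split=> [|k t u /asboolP[t' tt'] /asboolP[u' uu']]; apply/asboolP.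
  exists 0 => x y /=.
  by rewrite inner0l inner0r.
exists (Num.conj k *: t' + u') => x y /=.
by rewrite innerDl innerZl innerDr innerZr tt' uu'.
Qed.

HB.instance Definition _ :=
  GRing.isSubmodClosed.Build R[i] (E -> E) adjointable_pred adjointable_submod.
HB.instance Definition _ := [SubChoice_isSubLmodule of adjointable by <:].

Lemma adjointable_ext (t u : adjointable) : (forall x, t x = u x) -> t = u.
Proof. by move=> tu; apply/val_inj/funext. Qed.

Lemma adjointable_comp_subproof (t u : adjointable) :
  (t \o u) \in adjointable_pred.
Proof.
have /asboolP[t' tt'] := adjointable_funP t.
have /asboolP[u' uu'] := adjointable_funP u.
by apply/asboolP; exists (u' \o t') => x y /=; rewrite tt' uu'.
Qed.

Definition adjointable_comp (t u : adjointable) : adjointable :=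
  Adjointable (adjointable_comp_subproof t u).

Lemma adjoint_exists (t : adjointable) : exists s, is_adjoint t s.
Proof. exact/asboolP/adjointable_funP. Qed.

Definition adjoint_fun (t : adjointable) : E -> E :=
  projT1 (cid (adjoint_exists t)).

Lemma adjoint_funP (t : adjointable) : is_adjoint t (adjoint_fun t).
Proof. exact: projT2 (cid (adjoint_exists t)). Qed.

Lemma adjoint_subproof (t : adjointable) : adjoint_fun t \in adjointable_pred.
Proof. by apply/asboolP; exists t; apply/is_adjointC/adjoint_funP. Qed.

Definition adjoint (t : adjointable) : adjointable :=
  Adjointable (adjoint_subproof t).

Lemma adjointP (t : adjointable) x y : inner (t x) y = inner x (adjoint t y).
Proof. exact: adjoint_funP. Qed.

Lemma adjoint_unique (t u : adjointable) :
  (forall x y, inner (t x) y = inner x (u y)) -> adjoint t = u.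
Proof.
by move=> tu; apply: adjointable_ext => y; apply: inner_inj => x;
  rewrite -adjointP tu.
Qed.

Lemma adjointable_linear (t : adjointable) (k : R[i]) x y :
  t (k *: x + y) = k *: t x + t y.
Proof.
apply: inner_inj => z; rewrite innerDr innerZr.
have tl w : inner z (t w) = inner (adjoint t z) w.
  by rewrite -[RHS]inner_star -adjointP inner_star.
by rewrite !tl innerDr innerZr.
Qed.

Fact adjointable_compA : associative adjointable_comp.
Proof. by move=> t u v; apply: adjointable_ext. Qed.

Fact adjointable_compDl : left_distributive adjointable_comp +%R.
Proof. by move=> t u v; apply: adjointable_ext. Qed.

Fact adjointable_compDr : right_distributive adjointable_comp +%R.
Proof.
move=> t u v; apply: adjointable_ext => x.
by have := adjointable_linear t 1 (u x) (v x); rewrite !scale1r.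
Qed.

Fact adjointable_compZl (k : R[i]) (t u : adjointable) :
  adjointable_comp (k *: t) u = k *: adjointable_comp t u.
Proof. exact: adjointable_ext. Qed.

Fact adjointable_compZr (k : R[i]) (t u : adjointable) :
  adjointable_comp t (k *: u) = k *: adjointable_comp t u.
Proof.
apply: adjointable_ext => x.
have t0 : t 0 = 0.
  have := adjointable_linear t 1 0 0; rewrite !scale1r addr0 => /eqP.
  by rewrite -subr_eq0 opprD addrA subrr sub0r oppr_eq0 => /eqP.
by have := adjointable_linear t k (u x) 0; rewrite t0 !addr0.
Qed.

Fact adjointK : involutive adjoint.
Proof.
move=> t; apply: adjoint_unique => x y.
by rewrite -inner_star -adjointP inner_star.
Qed.

Fact adjointD (t u : adjointable) : adjoint (t + u) = adjoint t + adjoint u.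
Proof. by apply: adjoint_unique => x y; rewrite innerDl innerDr !adjointP. Qed.

Fact adjointZ (k : R[i]) (t : adjointable) :
  adjoint (k *: t) = Num.conj k *: adjoint t.
Proof. by apply: adjoint_unique => x y; rewrite innerZl innerZr adjointP. Qed.

Fact adjointM (t u : adjointable) :
  adjoint (adjointable_comp t u) = adjointable_comp (adjoint u) (adjoint t).
Proof. by apply: adjoint_unique => x y; rewrite /= !adjointP. Qed.

(* The operator norm of L(E) is not introduced: spectrum, positivity and
   functional calculus only involve the *-algebra structure. *)
HB.instance Definition _ := isStarAlgebra.Build R adjointable
  adjointable_compA adjointable_compDl adjointable_compDr
  adjointable_compZl adjointable_compZr
  adjointK adjointD adjointZ adjointM.

End Adjointable.

Arguments adjointable {R A} E.

(* Main.v *)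
(* A tangent line of s |-> s^r at m > 0 gives, by the functional calculus of t in
   L(E), the inequality
     <t^r x, x> >= r m^(r-1) <tx, x> - (r-1) m^r <x, x>    (r > 1)
   and the reverse one for 0 < r < 1. Here <x, x> is at most |x|^2, and taking
   the best m pointwise on the spectrum of <tx, x> yields the theorem. As the
   algebra is commutative, products of positive elements are positive, so the
   scalar inequalities for the various m can be glued by a partition of unity
   in the functional calculus of <tx, x>, without using characters. The functional
   calculi come from polynomial approximation once the norm of a self-adjoint
   element is known to be its spectral radius, which follows from square roots
   obtained by iteration. *)
Require Import Defs.
From HB Require Import structures.
From mathcomp Require Import all_boot all_order all_algebra.
From mathcomp Require Import complex.
From mathcomp Require Import all_classical all_reals all_analysis.
From mathcomp Require Import ring lra.
Set Implicit Arguments.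
Unset Strict Implicit.
Unset Printing Implicit Defensive.
Import Order.TTheory GRing.Theory Num.Theory.
Import numFieldNormedType.Exports.
Local Open Scope classical_set_scope.
Local Open Scope ring_scope.
Local Open Scope complex_scope.

(** * Unital C*-algebras *)

(** Powers in this setting are purely algebraic: [functional_calculus] is a choice with default 0,
    so nothing is known about t^r until a complete C*-norm is available and the calculus is shown to
    exist. [adjointable E] comes without a norm; building one takes Cauchy-Schwarz, boundedness of
    adjointable maps and completeness. A and L(E) are both unitized, and the spectral theory is
    proved once, for any unital algebra with a star and a norm satisfying [ucstar]. The constant
    |x|^(2(r-1)) comes from a change of scale. Put N = |x|^2 and use for t the tangent at m = l/N.
    Multiplied by N^(r-1), and with <x,x> replaced by N, the bound for <t^r x,x> becomes the tangent
    at l evaluated at <tx,x>. The replacement costs a multiple of N - <x,x>, and the factor r - 1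
    gives it the favourable sign in both cases. *)

Section ComplexNorm.
Context {R : realType}.
Implicit Types (z w : R[i]) (r : R).

(** The norm of [R[i]] is [R[i]]-valued; estimates are made over the reals, where [lra], square
    roots and infima live. *)
Definition cabs z : R := complex.Re `|z|.

Lemma cabsE z : `|z| = (cabs z)%:C.
Proof. by rewrite /cabs normc_def /=. Qed.

Lemma cabs_ge0 z : 0 <= cabs z.
Proof. by rewrite -ler0c -cabsE. Qed.

Lemma cabsM z w : cabs (z * w) = cabs z * cabs w.
Proof. by apply: complexI; rewrite rmorphM /= -!cabsE normrM. Qed.

Lemma cabsD z w : cabs (z + w) <= cabs z + cabs w.
Proof. by rewrite -lecR rmorphD /= -!cabsE ler_normD. Qed.

Lemma cabsN z : cabs (- z) = cabs z.
Proof. by rewrite /cabs normrN. Qed.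

Lemma cabs_real r : cabs r%:C = `|r|.
Proof. by rewrite /cabs normc_def /= expr0n addr0 sqrtr_sqr. Qed.

Lemma cabs1 : cabs 1 = 1.
Proof. by rewrite /cabs normr1. Qed.

Lemma cabs0 : cabs 0 = 0.
Proof. by rewrite /cabs normr0. Qed.

Lemma cabs_eq0 z : cabs z = 0 -> z = 0.
Proof. by move=> z0; apply/normr0_eq0; rewrite cabsE z0. Qed.

Lemma conj_realC r : Num.conj r%:C = r%:C :> R[i].
Proof. by apply/CrealP; apply/complex_realP; exists r. Qed.

Lemma cabs_conj z : cabs (Num.conj z) = cabs z.
Proof. by rewrite /cabs norm_conjC. Qed.

Lemma ge0_ReK z : 0 <= z -> z = (complex.Re z)%:C.
Proof. by move=> z0; rewrite RRe_real // ger0_real. Qed.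

Lemma cabs_le z r : (cabs z <= r) = (`|z| <= r%:C).
Proof. by rewrite cabsE lecR. Qed.

End ComplexNorm.

(** A predicate on a given star and norm, since it is instantiated on the unitizations of [A] and of
    [adjointable E], whose norms are constructed. The C*-identity is required in one direction only;
    the other follows from submultiplicativity. Completeness is phrased by sequences because [B] has
    no topology. *)
Record ucstar (R : realType) (B : algType R[i]) (st : B -> B) (nrm : B -> R) :
    Prop := {
  uc_starK : involutive st;
  uc_starD : forall a b, st (a + b) = st a + st b;
  uc_starZ : forall (k : R[i]) a, st (k *: a) = Num.conj k *: st a;
  uc_starM : forall a b, st (a * b) = st b * st a;
  uc_norm1 : nrm 1 = 1;
  uc_norm_eq0 : forall a, nrm a = 0 -> a = 0;
  uc_normD : forall a b, nrm (a + b) <= nrm a + nrm b;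
  uc_normZ : forall (k : R[i]) a, nrm (k *: a) = cabs k * nrm a;
  uc_normM : forall a b, nrm (a * b) <= nrm a * nrm b;
  uc_norm_star : forall a, nrm a ^+ 2 <= nrm (st a * a);
  uc_complete : forall u : nat -> B,
    (forall e : R, 0 < e -> exists N, forall m n, (N <= m)%N -> (N <= n)%N ->
       nrm (u m - u n) <= e) ->
    exists l, (fun n => nrm (u n - l)) @ \oo --> (0 : R)
}.

Definition invertible (R : pzRingType) (a : R) : Prop :=
  exists b, a * b = 1 /\ b * a = 1.

Lemma invertible_commM (R : pzRingType) (a b : R) :
  a * b = b * a -> invertible (a * b) -> invertible a.
Proof.
move=> ab [c [abc cab]]; exists (b * c); split; first by rewrite mulrA.
suff -> : b * c = c * b by rewrite -mulrA -ab.
by rewrite -[LHS]mul1r -[RHS]mulr1 -{1}cab -abc {1}ab !mulrA.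
Qed.

Lemma invertibleM (R : pzRingType) (a b : R) :
  invertible a -> invertible b -> invertible (a * b).
Proof.
move=> [a' [aa' a'a]] [b' [bb' b'b]]; exists (b' * a'); split.
  by rewrite mulrA -(mulrA a) bb' mulr1.
by rewrite mulrA -(mulrA b') a'a mulr1.
Qed.

Lemma invertibleZ (F : fieldType) (B : algType F) (k : F) (a : B) :
  invertible (k *: a) -> invertible a.
Proof.
move=> [b [ab ba]]; exists (k *: b).
by split; [rewrite -scalerAr scalerAl ab | rewrite -scalerAl scalerAr ba].
Qed.

Section UnitalCstar.
Context {R : realType} {B : algType R[i]} {st : B -> B} {nrm : B -> R}.
Hypothesis H : ucstar st nrm.
Implicit Types (a b c : B) (r : R).
Let starK := uc_starK H.
Let starD := uc_starD H.
Let starZ := uc_starZ H.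
Let starM := uc_starM H.

Lemma uc_star0 : st 0 = 0.
Proof. by have := starZ 0 0; rewrite conjC0 !scale0r. Qed.

Lemma uc_starN a : st (- a) = - st a.
Proof. by rewrite -scaleN1r starZ rmorphN rmorph1 scaleN1r. Qed.

Lemma uc_starB a b : st (a - b) = st a - st b.
Proof. by rewrite starD uc_starN. Qed.

Lemma uc_star1 : st 1 = 1.
Proof. by rewrite -[LHS]mulr1 -[X in st 1 * X]starK -starM mulr1 starK. Qed.

Lemma uc_starR r : st r%:C%:A = r%:C%:A.
Proof. by rewrite starZ uc_star1 conj_realC. Qed.

Lemma uc_norm0 : nrm 0 = 0.
Proof. by have := uc_normZ H 0 0; rewrite scale0r cabs0 mul0r. Qed.

Lemma uc_normN a : nrm (- a) = nrm a.
Proof. by rewrite -scaleN1r (uc_normZ H) cabsN cabs1 mul1r. Qed.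

Lemma uc_norm_ge0 a : 0 <= nrm a.
Proof.
have := uc_normD H a (- a); rewrite subrr uc_norm0 uc_normN -mulr2n.
by rewrite pmulrn_lge0.
Qed.

Lemma uc_normBC a b : nrm (a - b) = nrm (b - a).
Proof. by rewrite -uc_normN opprB. Qed.

Lemma uc_normR r : nrm r%:C%:A = `|r|.
Proof. by rewrite (uc_normZ H) (uc_norm1 H) mulr1 cabs_real. Qed.

(** The C*-inequality gives |b|^2 <= |b^*| |b|; divide by |b|, then exchange b and its star. *)
Lemma uc_norm_starE a : nrm (st a) = nrm a.
Proof.
suff le b : nrm b <= nrm (st b).
  by apply/eqP; rewrite eq_le le -{2}[a]starK le.
have := le_trans (uc_norm_star H b) (uc_normM H (st b) b).
have [b0|b0] := eqVneq (nrm b) 0; first by rewrite b0 (uc_norm_ge0 (st b)).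
by rewrite expr2 ler_pM2r // lt_def b0 uc_norm_ge0.
Qed.

Lemma uc_norm_saM a : st a = a -> nrm (a * a) = nrm a ^+ 2.
Proof.
move=> sa; apply/eqP; rewrite eq_le {1}expr2 (uc_normM H) /=.
by rewrite -{2}sa (uc_norm_star H).
Qed.

(** * Norm convergence, geometric series and square roots *)

Definition tends (u : nat -> B) (l : B) : Prop :=
  (fun n => nrm (u n - l)) @ \oo --> (0 : R).

Lemma tends_squeeze (u : nat -> B) l (d : nat -> R) :
  (forall n, nrm (u n - l) <= d n) -> d @ \oo --> (0 : R) -> tends u l.
Proof.
move=> ud d0; apply: (@squeeze_cvgr _ _ _ _ (cst 0) d); last exact: d0.
  by near=> n; rewrite uc_norm_ge0 ud.
exact: cvg_cst.
Unshelve. all: end_near. Qed.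

Lemma tends_cst a : tends (cst a) a.
Proof.
apply: (@tends_squeeze _ _ (cst 0)) => [n|]; last exact: cvg_cst.
by rewrite subrr uc_norm0.
Qed.

Lemma tendsD u v l m : tends u l -> tends v m ->
  tends (fun n => u n + v n) (l + m).
Proof.
move=> ul vm.
apply: (@tends_squeeze _ _ (fun n => nrm (u n - l) + nrm (v n - m))) => [n|].
  by rewrite opprD addrACA (uc_normD H).
by rewrite -[X in _ --> X](addr0 (0 : R)); apply: (@cvgD R R^o).
Qed.

Lemma tendsZ (k : R[i]) u l : tends u l -> tends (fun n => k *: u n) (k *: l).
Proof.
move=> ul.
apply: (@tends_squeeze _ _ (fun n => cabs k * nrm (u n - l))) => [n|].
  by rewrite -scalerBr (uc_normZ H).
rewrite -[X in _ --> X](mulr0 (cabs k)).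
by apply: cvgM => //; apply: cvg_cst.
Qed.

Lemma tends_star u l : tends u l -> tends (fun n => st (u n)) (st l).
Proof.
move=> ul; apply: (@tends_squeeze _ _ (fun n => nrm (u n - l))) => [n|//].
by rewrite -uc_starB uc_norm_starE.
Qed.

Lemma tendsM u v l m : tends u l -> tends v m ->
  tends (fun n => u n * v n) (l * m).
Proof.
move=> ul vm.
apply: (@tends_squeeze _ _ (fun n =>
   nrm (u n - l) * (nrm (v n - m) + nrm m) + nrm l * nrm (v n - m))) => [n|].
  have -> : u n * v n - l * m = (u n - l) * v n + l * (v n - m).
    by rewrite mulrBl mulrBr addrA subrK.
  apply: (le_trans (uc_normD H _ _)); rewrite lerD ?(uc_normM H) //.
  apply: (le_trans (uc_normM H _ _)); rewrite ler_wpM2l ?uc_norm_ge0 //.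
  by rewrite -{1}(subrK m (v n)) (uc_normD H).
have -> : (0 : R) = 0 * (0 + nrm m) + nrm l * 0 by rewrite mul0r mulr0 addr0.
apply: (@cvgD R R^o).
  by apply: cvgM => //; apply: (@cvgD R R^o) => //; apply: cvg_cst.
by apply: cvgM => //; apply: cvg_cst.
Qed.

Lemma tends_shift u l : tends u l -> tends (fun n => u n.+1) l.
Proof. by move=> ul; rewrite /tends (cvg_shiftS (fun n => nrm (u n - l))). Qed.

Lemma tends_small u l : tends u l ->
  forall e, 0 < e -> exists N, forall n, (N <= n)%N -> nrm (u n - l) <= e.
Proof.
move=> ul e e0.
have [N _ uN] := cvgr0_norm_le _ ul _ e0.
by exists N => n Nn; apply: le_trans (uN _ Nn); rewrite ler_norm.
Qed.

Lemma tends_unique u l m : tends u l -> tends u m -> l = m.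
Proof.
move=> ul um; apply/eqP; rewrite -subr_eq0; apply/eqP/(uc_norm_eq0 H)/eqP.
rewrite eq_le uc_norm_ge0 andbT; apply/ler_addgt0Pr => e e0.
have e20 : 0 < e / 2 by rewrite divr_gt0.
have [N uN] := tends_small ul e20.
have [M uM] := tends_small um e20.
have -> : l - m = (l - u (maxn N M)) + (u (maxn N M) - m) by rewrite addrA subrK.
rewrite add0r (le_trans (uc_normD H _ _)) // (splitr e) lerD //.
  by rewrite uc_normBC uN // leq_maxl.
by rewrite uM // leq_maxr.
Qed.

(** The majorant method: [v] is nondecreasing and bounded, hence Cauchy, and its increments control
    those of [u]. It serves both the geometric series and the square root iteration. *)
Lemma uc_majorized_cvg (u : nat -> B) (v : nat -> R) (r : R) :
  (forall n, nrm (u n.+1 - u n) <= v n.+1 - v n) -> (forall n, v n <= r) ->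
  exists l, tends u l.
Proof.
move=> uv vr; apply: (uc_complete H) => e e0.
have le n k : nrm (u (n + k)%N - u n) <= v (n + k)%N - v n.
  elim: k => [|k IH]; first by rewrite addn0 !subrr uc_norm0.
  rewrite addnS.
  have -> : u (n + k).+1 - u n = (u (n + k).+1 - u (n + k)%N) + (u (n + k)%N - u n).
    by rewrite addrA subrK.
  rewrite (le_trans (uc_normD H _ _)) // (le_trans (lerD (uv _) IH)) //.
  by rewrite addrA subrK.
have ndv : {homo v : m n / (m <= n)%N >-> m <= n}.
  apply: homo_leq => [//|x y z|n]; first exact: le_trans.
  by rewrite -subr_ge0 (le_trans (uc_norm_ge0 _) (uv n)).
have /cvg_ex[/= s vs] : cvgn v by apply: nondecreasing_is_cvgn => //; exists r => _ [n _ <-].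
have e20 : 0 < e / 2 by rewrite divr_gt0.
have [N _ vN] := cvgr_dist_le _ _ vs _ e20.
exists N => m n.
wlog mn : m n / (n <= m)%N => [hw Nm Nn|Nm Nn].
  by have [mn|nm] := leqP n m; [|rewrite uc_normBC]; apply: hw => //; apply: ltnW.
rewrite -(subnKC mn) (le_trans (le _ _)) // subnKC //.
have -> : v m - v n = - (s - v m) + (s - v n) by ring.
rewrite (splitr e) (le_trans (ler_norm _)) // (le_trans (ler_normD _ _)) //.
by rewrite normrN lerD ?vN.
Qed.

(** The partial sums of the geometric series are majorized by the scalar ones, which stay below 1/(1
    - |a|). The limit satisfies l = 1 + a l and commutes with a, so it is a two-sided inverse. *)
Lemma uc_neumann a : nrm a < 1 -> invertible (1 - a).
Proof.
move=> a1; pose u := fix u n := if n is m.+1 then 1 + a * u m else 1.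
pose v := fix v n : R := if n is m.+1 then 1 + nrm a * v m else 1.
have v_le n : v n <= (1 - nrm a)^-1.
  have d0 : 0 < 1 - nrm a by rewrite subr_gt0.
  elim: n => [|n IH] /=; first by rewrite invf_ge1 // gerBl uc_norm_ge0.
  rewrite (le_trans (lerD (lexx 1) (ler_wpM2l (uc_norm_ge0 _) IH))) //.
  by rewrite le_eqVlt; apply/orP; left; apply/eqP; field; lra.
have uv n : nrm (u n.+1 - u n) <= v n.+1 - v n.
  elim: n => [|n IH].
    by rewrite /= !mulr1 addrC addKr [1 + nrm a]addrC addrK.
  have -> : u n.+2 - u n.+1 = a * (u n.+1 - u n).
    transitivity ((1 + a * u n.+1) - (1 + a * u n)) => //.
    by rewrite opprD addrACA subrr add0r mulrBr.
  have -> : v n.+2 - v n.+1 = nrm a * (v n.+1 - v n).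
    transitivity ((1 + nrm a * v n.+1) - (1 + nrm a * v n)) => //.
    by rewrite opprD addrACA subrr add0r mulrBr.
  by rewrite (le_trans (uc_normM H _ _)) // ler_wpM2l // uc_norm_ge0.
have [l ul] := uc_majorized_cvg uv v_le.
have comm n : u n * a = a * u n.
  elim: n => [|n IH] /=; first by rewrite mulr1 mul1r.
  by rewrite mulrDl mulrDr mulr1 mul1r -mulrA IH.
have la : l * a = a * l.
  apply: (@tends_unique (fun n => u n * a)).
    exact: (tendsM ul (tends_cst a)).
  rewrite (_ : (fun n => _) = (fun n => a * u n)); last exact/funext.
  exact: (tendsM (tends_cst a) ul).
have El : l = 1 + a * l.
  apply: (tends_unique (tends_shift ul)).
  exact: (tendsD (tends_cst 1) (tendsM (tends_cst a) ul)).
by exists l; split; rewrite ?mulrBl ?mulrBr ?la ?mulr1 ?mul1r {1}El addrK.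
Qed.

Lemma half_scaleD (V : lmodType R[i]) (x : V) :
  (2^-1)%:C *: x + (2^-1)%:C *: x = x.
Proof. by rewrite -scalerDl -rmorphD -[2^-1]mul1r -splitr rmorph1 scale1r. Qed.

(* The iteration y |-> (a + y^2) / 2 converges to 1 - sqrt (1 - a); it is
   dominated by the same scalar iteration started from norm 1. *)
Lemma uc_sqrt a : st a = a -> nrm a <= 1 ->
  exists g, [/\ st g = g, g * g = 1 - a & forall z, z * a = a * z -> z * g = g * z].
Proof.
move=> sa a1; pose h : R[i] := (2^-1)%:C.
pose u := fix u n := if n is m.+1 then h *: (a + u m * u m) else 0.
pose v := fix v n : R := if n is m.+1 then 2^-1 * (1 + v m * v m) else 0.
have uS n : u n.+1 = h *: (a + u n * u n) by [].
have vS n : v n.+1 = 2^-1 * (1 + v n * v n) by [].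
have v01 n : 0 <= v n <= 1.
  elim: n => [|n /andP[v0 v1]]; first by rewrite lexx ler01.
  by rewrite vS; apply/andP; split; nra.
have u_comm z n : z * a = a * z -> z * u n = u n * z.
  move=> za; elim: n => [|n IH]; first by rewrite mulr0 mul0r.
  by rewrite uS -scalerAr -scalerAl mulrDr mulrDl za mulrA IH -mulrA IH mulrA.
have su n : st (u n) = u n.
  elim: n => [|n IH]; first exact: uc_star0.
  by rewrite uS starZ conj_realC starD starM sa IH.
have nh : cabs h = 2^-1 by rewrite cabs_real ger0_norm // invr_ge0.
have uv n : nrm (u n) <= v n.
  elim: n => [|n IH]; first by rewrite uc_norm0.
  rewrite uS vS (uc_normZ H) nh ler_wpM2l ?invr_ge0 //.
  rewrite (le_trans (uc_normD H _ _)) // lerD // (le_trans (uc_normM H _ _)) //.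
  by apply: ler_pM => //; apply: uc_norm_ge0.
have duv n : nrm (u n.+1 - u n) <= v n.+1 - v n.
  elim: n => [|n IH].
    rewrite uS vS /= !mulr0 !subr0 (uc_normZ H) nh !addr0 mulr1.
    by rewrite -[leRHS]mulr1 ler_wpM2l ?invr_ge0.
  (* [u n] and [u n.+1] commute, so the difference of squares factors exactly as in the scalar
     recursion for [v]. *)
  have -> : u n.+2 - u n.+1 = h *: ((u n.+1 - u n) * (u n.+1 + u n)).
    rewrite [u n.+2]uS [u n.+1 in X in _ - X]uS -scalerBr opprD addrACA subrr add0r.
    congr (_ *: _); rewrite mulrBl !mulrDr [u n * u n.+1]u_comm.
      by rewrite opprD addrA addrK.
    exact/esym/u_comm.
  have -> : v n.+2 - v n.+1 = 2^-1 * ((v n.+1 - v n) * (v n.+1 + v n)).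
    by rewrite [v n.+2]vS {3}[v n.+1]vS; ring.
  rewrite (uc_normZ H) nh ler_wpM2l ?invr_ge0 //.
  rewrite (le_trans (uc_normM H _ _)) // ler_pM ?uc_norm_ge0 //.
  by rewrite (le_trans (uc_normD H _ _)) // lerD.
have [l ul] := uc_majorized_cvg duv (fun n => proj2 (andP (v01 n))).
have El : l = h *: (a + l * l).
  apply: (tends_unique (tends_shift ul)).
  exact: (tendsZ h (tendsD (tends_cst a) (tendsM ul ul))).
exists (1 - l); split.
- rewrite uc_starB uc_star1; congr (_ - _); apply: (tends_unique (tends_star ul)).
  by rewrite (_ : (fun n => _) = u) //; apply/funext.
- have El2 : l + l = a + l * l by rewrite {1 2}El half_scaleD.
  have -> : a = l + l - l * l by rewrite El2 addrK.
  by rewrite mulrBl mul1r mulrBr mulr1 !opprB opprD !addrA (addrAC 1).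
- move=> z za; rewrite mulrBr mulrBl mul1r mulr1; congr (_ - _).
  apply: (@tends_unique (fun n => z * u n)).
    exact: (tendsM (tends_cst z) ul).
  rewrite (_ : (fun n => _) = (fun n => u n * z)).
    exact: (tendsM ul (tends_cst z)).
  by apply/funext => n; apply: u_comm.
Qed.

(* The C*-identity for c = a + ib, whose square modulus is a^2 + b^2. *)
Lemma uc_norm_sumsq a b : st a = a -> st b = b -> a * b = b * a ->
  nrm a ^+ 2 <= nrm (a * a + b * b).
Proof.
move=> sa sb ab; pose c := a + 'i%R *: b.
have sc : st c = a - 'i%R *: b by rewrite starD starZ sa sb conjCi scaleNr.
have cc : st c * c = a * a + b * b.
  rewrite sc mulrBl !mulrDr -!scalerAl -!scalerAr scalerA -(expr2 'i%R) sqrCi scaleN1r ab.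
  by rewrite opprB -addrA (addrCA _ (b * b)) subrr addr0.
have ac : nrm a <= nrm c.
  have -> : a = (2^-1)%:C *: (c + st c).
    by rewrite sc addrACA subrr addr0 scalerDr half_scaleD.
  rewrite (uc_normZ H) cabs_real ger0_norm ?invr_ge0 //.
  rewrite ler_pdivrMl // (le_trans (uc_normD H _ _)) // uc_norm_starE.
  by rewrite mulr_natl mulr2n.
rewrite -cc; apply: le_trans (uc_norm_star H c).
by rewrite ler_sqr ?nnegrE ?uc_norm_ge0.
Qed.

(** Scale to c = a/r, so that |c| <= 1, and write 1 - c^2 = g^2. As c and g commute, |g|^2 <= |g^2 +
    c^2| = 1. This estimate is the form in which squares are positive before any spectral theory. *)
Lemma uc_norm_subsq a r : st a = a -> nrm a <= r ->
  nrm ((r ^+ 2)%:C%:A - a * a) <= r ^+ 2.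
Proof.
move=> sa ar.
have [r0|r0] := eqVneq r 0.
  have a0 : a = 0.
    by apply/(uc_norm_eq0 H)/eqP; rewrite eq_le uc_norm_ge0 andbT -r0.
  by rewrite r0 a0 mul0r expr0n /= scale0r subr0 uc_norm0.
have rp : 0 < r by rewrite lt_def r0 (le_trans (uc_norm_ge0 a)).
pose c := r^-1%:C *: a.
have sc : st c = c by rewrite starZ conj_realC sa.
have c1 : nrm c <= 1.
  by rewrite (uc_normZ H) cabs_real ger0_norm ?invr_ge0 ?(ltW rp) // ler_pdivrMl // mulr1.
have cc1 : nrm (c * c) <= 1.
  by rewrite (le_trans (uc_normM H _ _)) // mulr_ile1 ?uc_norm_ge0.
have scc : st (c * c) = c * c by rewrite starM sc.
have [g [sg gg gc]] := uc_sqrt scc cc1.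
have cg : c * g = g * c by apply: gc; rewrite mulrA.
have g1 : nrm g ^+ 2 <= 1.
  by rewrite (le_trans (uc_norm_sumsq sg sc (esym cg))) // gg subrK (uc_norm1 H).
have -> : (r ^+ 2)%:C%:A - a * a = (r ^+ 2)%:C *: (g * g).
  rewrite gg scalerBr; congr (_ - _).
  have ra : a = r%:C *: c by rewrite scalerA -rmorphM /= mulfV // scale1r.
  by rewrite {1 2}ra -scalerAl -scalerAr scalerA -rmorphM -expr2.
rewrite (uc_normZ H) cabs_real ger0_norm ?sqr_ge0 // (uc_norm_saM sg).
by rewrite ler_piMr ?sqr_ge0.
Qed.

Lemma uc_invertible_near a (k : R[i]) : nrm (k%:A - a) < cabs k -> invertible a.
Proof.
move=> ka; have k0 : k != 0.
  by apply: contraTneq ka => ->; rewrite cabs0 -leNgt uc_norm_ge0.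
apply: (@invertibleZ _ _ k^-1).
have -> : k^-1 *: a = 1 - k^-1 *: (k%:A - a).
  by rewrite scalerBr scalerA mulVf // scale1r opprB addrC subrK.
apply: uc_neumann; rewrite (uc_normZ H).
have ck : cabs k * cabs k^-1 = 1 by rewrite -cabsM mulfV // cabs1.
rewrite -ck mulrC ltr_pM2r // lt_def cabs_ge0 andbT.
by apply/eqP => /cabs_eq0 /eqP; rewrite invr_eq0 (negbTE k0).
Qed.

(** * Spectra of self-adjoint elements and of polynomials in them *)

Definition sp a : set R[i] := [set z | ~ invertible (a - z%:A)].

Lemma sp_norm a z : sp a z -> cabs z <= nrm a.
Proof.
move=> az; rewrite leNgt; apply/negP => za; apply: az.
apply: (@uc_invertible_near _ (- z)).
by rewrite cabsN scaleNr opprB addKr uc_normN.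
Qed.

Lemma sp_open a z : ~ sp a z ->
  exists2 d : R, 0 < d & forall w, cabs (w - z) < d -> ~ sp a w.
Proof.
move=> /contrapT[b [zb bz]].
(* The [+ 1] keeps the radius positive whatever [nrm b] is. *)
exists (nrm b + 1)^-1; first by rewrite invr_gt0 ltr_wpDl // uc_norm_ge0.
move=> w wz; apply; apply: (@invertible_commM _ _ b).
  rewrite (_ : a - w%:A = (a - z%:A) - (w - z)%:A); last first.
    by rewrite scalerBl opprB addrA subrK.
  by rewrite mulrBl mulrBr zb bz -scalerAl -scalerAr mul1r mulr1.
apply: (@uc_invertible_near _ 1).
rewrite (_ : a - w%:A = (a - z%:A) - (w - z)%:A); last first.
  by rewrite scalerBl opprB addrA subrK.
rewrite mulrBl zb scale1r opprB addrC subrK cabs1 -scalerAl mul1r (uc_normZ H).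
have b0 := uc_norm_ge0 b.
rewrite (@le_lt_trans _ _ (cabs (w - z) * (nrm b + 1))) //.
  by rewrite ler_wpM2l ?cabs_ge0 // lerDl.
by rewrite -ltr_pdivlMr ?mul1r // ltr_wpDl.
Qed.

(** With K = |a|, the element K^2 - a^2 has norm at most K^2 < K^2 + y^2, so a^2 + y^2 is a small
    perturbation of the scalar K^2 + y^2. *)
Lemma uc_invertible_sqD a (y : R) : st a = a -> y != 0 ->
  invertible (a * a + (y ^+ 2)%:C%:A).
Proof.
move=> sa y0; set K := nrm a.
apply: (@uc_invertible_near _ (K ^+ 2 + y ^+ 2)%:C).
rewrite rmorphD /= scalerDl opprD addrACA addrC -addrA.
rewrite addNKr -rmorphD.
have K0 : 0 <= K ^+ 2 by rewrite sqr_ge0.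
have yy : 0 < y ^+ 2 by rewrite exprn_even_gt0.
rewrite cabs_real ger0_norm; last lra.
by rewrite (le_lt_trans (uc_norm_subsq sa (lexx K))) // /K ltrDl.
Qed.

(** If z = x + iy with y nonzero and b = a - x, the factors of (b - iy)(b + iy) = b^2 + y^2 commute
    and the product is invertible. *)
Lemma sp_real a z : st a = a -> sp a z -> z = (complex.Re z)%:C.
Proof.
move=> sa; case: z => x y; have [-> //|y0] := eqVneq y 0; case.
pose b := a - x%:C%:A.
have sb : st b = b by rewrite uc_starB sa uc_starR.
pose k : R[i] := 'i%R * y%:C.
have -> : a - (x +i* y)%:A = b - k%:A.
  by rewrite (complexE (x +i* y)) /= -addrA -opprD -scalerDl.
move: b sb => b sb.
have kb : k%:A * b = b * k%:A by rewrite -scalerAl -scalerAr mul1r mulr1.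
have sq : (b - k%:A) * (b + k%:A) = b * b - k%:A * k%:A.
  by rewrite mulrBl !mulrDr kb opprD addrA addrK.
apply: (@invertible_commM _ _ (b + k%:A)).
  by rewrite sq mulrDl !mulrBr kb addrA subrK.
rewrite sq -scalerAl mul1r scalerA -scaleNr -(expr2 k) exprMn sqrCi mulN1r opprK.
rewrite -rmorphXn.
exact: uc_invertible_sqD.
Qed.

(* No complex analysis: normalise to |a| = 1 and suppose that 1 - a^2 has an
   inverse d. Since 1 - d / |d| = h^2 and 1 - a^2 = g^2 have self-adjoint roots,
   a^2 + (hg)^2 = 1 - 1 / |d|, whence |a|^2 <= 1 - 1 / |d| < 1. *)
Lemma uc_norm_spectral a r : st a = a -> 0 <= r ->
  (forall z, sp a z -> cabs z <= r) -> nrm a <= r.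
Proof.
move=> sa r0 spr; rewrite leNgt; apply/negP => ra.
set K := nrm a in ra; have K0 : 0 < K by apply: le_lt_trans ra.
pose c := K^-1%:C *: a.
have aK : a = K%:C *: c.
  by rewrite scalerA -rmorphM /= mulfV ?gt_eqF // scale1r.
have sc : st c = c by rewrite starZ conj_realC sa.
have c1 : nrm c = 1.
  rewrite (uc_normZ H) cabs_real ger0_norm ?invr_ge0 ?(ltW K0) //.
  by rewrite mulVf ?gt_eqF.
have invK (s : R) : `|s| = K -> invertible (a - s%:C%:A).
  move=> sK; apply: contrapT => /(spr s%:C).
  by rewrite cabs_real sK leNgt ra.
have i1 : invertible (1 - c).
  apply: (@invertibleZ _ _ (- K%:C)).
  rewrite scalerBr !scaleNr -aK opprK addrC; apply: invK.
  by rewrite ger0_norm // ltW.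
have i2 : invertible (1 + c).
  apply: (@invertibleZ _ _ K%:C).
  rewrite scalerDr -aK addrC -[_%:A]opprK -scaleNr -rmorphN; apply: invK.
  by rewrite normrN ger0_norm // ltW.
pose b := c * c; have sb : st b = b by rewrite starM sc.
have b1E : 1 - b = (1 - c) * (1 + c).
  by rewrite mulrBl mul1r mulrDr mulr1 opprD addrA addrK.
have nb : nrm b <= 1 by rewrite (uc_norm_saM sc) c1 expr1n.
have n1b : nrm (1 - b) <= 1.
  have c1' : nrm c <= 1 by rewrite c1.
  have := uc_norm_subsq sc c1'; by rewrite expr1n scale1r.
have [d [bd db]] : invertible (1 - b) by rewrite b1E; apply: invertibleM.
have d_comm z : z * (1 - b) = (1 - b) * z -> z * d = d * z.
  by move=> zb; rewrite -[LHS]mul1r -db -(mulrA d) (mulrA (1 - b)) -zb -mulrA bd mulr1.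
have sd : st d = d.
  have : st d * (1 - b) = 1.
    by rewrite -[RHS]uc_star1 -[X in _ = st X]bd starM uc_starB uc_star1 sb.
  by move=> sdb; rewrite -[LHS]mulr1 -bd mulrA sdb mul1r.
set D := nrm d.
have D1 : 1 <= D.
  rewrite -(uc_norm1 H) -bd (le_trans (uc_normM H _ _)) //.
  by rewrite -[leRHS]mul1r ler_wpM2r // uc_norm_ge0.
have D0 : 0 < D by apply: lt_le_trans D1.
pose e := D^-1%:C *: d.
have se : st e = e by rewrite starZ conj_realC sd.
have ne : nrm e <= 1.
  by rewrite (uc_normZ H) cabs_real ger0_norm ?invr_ge0 ?(ltW D0) // mulVf ?gt_eqF.
have [g [sg gg gc]] := uc_sqrt sb nb.
have [h [sh hh hc]] := uc_sqrt se ne.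
have e_comm z : z * b = b * z -> z * e = e * z.
  move=> zb; rewrite /e -scalerAr -scalerAl d_comm //.
  by rewrite mulrBr mulrBl mulr1 mul1r zb.
have cb : c * b = b * c by rewrite /b mulrA.
have gh : g * h = h * g.
  by apply: hc; apply: e_comm; apply/esym/gc.
have ch : c * h = h * c by apply: hc; apply: e_comm.
have cg : c * g = g * c by apply: gc.
pose f := h * g.
have sf : st f = f by rewrite starM sg sh.
have cf : c * f = f * c by rewrite /f mulrA ch -[LHS]mulrA cg mulrA.
have ff : c * c + f * f = (1 - D^-1)%:C%:A.
  have -> : f * f = (1 - e) * (1 - b).
    by rewrite /f -hh -gg mulrA -(mulrA h g h) gh !mulrA.
  have eb : e * (1 - b) = D^-1%:C%:A by rewrite -scalerAl db.
  rewrite [(1 - e) * _]mulrBl mul1r eb rmorphB scalerBl rmorph1 scale1r addrA.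
  by congr (_ - _); rewrite addrC subrK.
have := uc_norm_sumsq sc sf cf.
rewrite ff uc_normR c1 expr1n ger0_norm ?subr_ge0 ?invf_le1 //.
by rewrite leNgt ltrBlDr ltrDl invr_gt0 D0.
Qed.

Lemma invertible_prod (I : eqType) (s : seq I) (F : I -> B) :
  {in s, forall i, invertible (F i)} -> invertible (\prod_(i <- s) F i).
Proof.
elim: s => [|i s IH] inv; first by rewrite big_nil; exists 1; rewrite mulr1.
rewrite big_cons; apply: invertibleM; first by apply: inv; rewrite mem_head.
by apply: IH => j js; apply: inv; rewrite in_cons js orbT.
Qed.

(** Over the algebraically closed field [R[i]], p - z splits into linear factors; if all its roots
    avoided the spectrum of a, p(a) - z would be a product of invertible elements. The point [w0]
    answers the case where p is the constant z. *)
Lemma sp_horner a (p : {poly R[i]}) z w0 : sp a w0 -> sp (horner_alg a p) z ->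
  exists2 w, sp a w & p.[w] = z.
Proof.
move=> aw0 pz; have [q0|q0] := eqVneq (p - z%:P) 0.
  by exists w0 => //; move/eqP: q0; rewrite subr_eq0 => /eqP ->; rewrite hornerC.
have [s qE] := closed_field_poly_normal (p - z%:P).
apply: contrapT => nex; apply: pz.
have -> : horner_alg a p - z%:A = horner_alg a (p - z%:P).
  by rewrite rmorphB /= horner_algC.
have l0 : (lead_coef (p - z%:P))^-1 * lead_coef (p - z%:P) = 1.
  by rewrite mulVf // lead_coef_eq0.
set l := lead_coef _ in qE l0.
apply: (@invertibleZ _ _ l^-1); rewrite qE linearZ /= mulr_algl.
rewrite scalerA l0 scale1r.
rewrite rmorph_prod; apply: invertible_prod => r rs.
rewrite rmorphB /= horner_algX horner_algC; apply: contrapT => ar.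
apply: nex; exists r => //; apply/eqP; rewrite -subr_eq0 -[X in _ - X](hornerC z r).
rewrite -hornerN -hornerD qE hornerZ mulf_eq0; apply/orP; right.
by rewrite -rootE root_prod_XsubC.
Qed.

Lemma uc_star_horner a (p : {poly R[i]}) : st a = a ->
  st (horner_alg a p) = horner_alg a (map_poly Num.conj p).
Proof.
move=> sa; elim/poly_ind: p => [|p k IH]; first by rewrite rmorph0 !raddf0 uc_star0.
rewrite !rmorphD !rmorphM /= map_polyX map_polyC /= !horner_algX !horner_algC.
rewrite starD starM starZ uc_star1 IH sa; congr (_ + _).
by rewrite -{1 4}(horner_algX a) -!rmorphM mulrC.
Qed.

(** For P = p(a), which may fail to be self-adjoint, |P|^2 <= |P^* P|, and P^* P is q(a) with q =
    conj(p) p, equal to |p|^2 on the real spectrum. The spectral bound applies to q(a). *)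
Lemma uc_norm_horner a (p : {poly R[i]}) (m : R) w0 : st a = a -> sp a w0 ->
  (forall w, sp a w -> cabs p.[w] <= m) -> nrm (horner_alg a p) <= m.
Proof.
move=> sa aw0 pm; have m0 : 0 <= m by apply: le_trans (pm _ aw0); apply: cabs_ge0.
rewrite -(@ler_sqr _ _ m) ?nnegrE ?uc_norm_ge0 //.
apply: le_trans (uc_norm_star H _) _.
apply: uc_norm_spectral => [||z]; rewrite ?sqr_ge0 ?starM ?starK //.
rewrite uc_star_horner // -rmorphM => /(sp_horner aw0)[w aw <-].
rewrite hornerM (sp_real sa aw) -[X in (map_poly _ _).[X]]conj_realC horner_map.
rewrite cabsM cabs_conj -(sp_real sa aw) -expr2 ler_sqr ?nnegrE ?cabs_ge0 //.
exact: pm.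
Qed.

(** * Positive elements: sums, square roots, products, order and norm *)

Definition upos a : Prop := st a = a /\ forall z, sp a z -> 0 <= z.

(** Together with [upos_norm] this turns positivity into the norm condition |r - a| <= r, in which
    closure under sums is the triangle inequality. *)
Lemma upos_near a (r : R) : st a = a -> nrm (r%:C%:A - a) <= r -> upos a.
Proof.
move=> sa ra; split=> // z az; have zE := sp_real sa az.
rewrite zE ler0c leNgt; apply/negP => z0; apply: az; rewrite zE.
set x := complex.Re z in z0 *.
apply: (@uc_invertible_near _ (r - x)%:C).
rewrite (_ : _ - _ = r%:C%:A - a).
  have r0 := le_trans (uc_norm_ge0 _) ra.
  by rewrite cabs_real ger0_norm; lra.
by rewrite rmorphB scalerBl opprB addrA subrK.
Qed.

Lemma sp_subr a (k z : R[i]) : sp (k%:A - a) z -> sp a (k - z).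
Proof.
move=> kz; apply: contra_not kz => inv; apply: (@invertibleZ _ _ (-1)).
rewrite scaleN1r (_ : - (k%:A - a - z%:A) = a - (k - z)%:A) //.
by rewrite opprB scalerBl !opprB addrCA.
Qed.

Lemma upos_norm a (r : R) : upos a -> nrm a <= r -> nrm (r%:C%:A - a) <= r.
Proof.
move=> [sa pa] ar; have r0 := le_trans (uc_norm_ge0 _) ar.
have sra : st (r%:C%:A - a) = r%:C%:A - a by rewrite uc_starB uc_starR sa.
apply: uc_norm_spectral => // z rz; have zE := sp_real sra rz.
have az := sp_subr rz; have := sp_norm az; have := pa _ az.
rewrite zE -rmorphB ler0c !cabs_real => x0; rewrite ger0_norm // => xr.
by rewrite ger0_norm; lra.
Qed.

Lemma uposD a b : upos a -> upos b -> upos (a + b).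
Proof.
move=> pa pb; apply: (@upos_near _ (nrm a + nrm b)).
  by rewrite starD (proj1 pa) (proj1 pb).
rewrite rmorphD scalerDl opprD addrACA (le_trans (uc_normD H _ _)) //.
by rewrite lerD ?upos_norm.
Qed.

Lemma upos0 : upos 0.
Proof.
by apply: (@upos_near _ 0); rewrite ?uc_star0 // scale0r subr0 uc_norm0.
Qed.

Lemma upos_sum (I : Type) (s : seq I) (P : pred I) (F : I -> B) :
  (forall i, P i -> upos (F i)) -> upos (\sum_(i <- s | P i) F i).
Proof. by move=> pF; apply: big_ind => //; [exact: upos0|exact: uposD]. Qed.

Lemma upos_sq s : st s = s -> upos (s * s).
Proof.
move=> ss; apply: (@upos_near _ (nrm s ^+ 2)); first by rewrite starM ss.
exact: uc_norm_subsq.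
Qed.

(** By [upos_norm], 1 - a/|a| has norm at most 1, so [uc_sqrt] yields a root of a/|a|. The
    commutation clause makes roots of commuting elements commute. *)
Lemma upos_sqrt a : upos a ->
  exists s, [/\ st s = s, s * s = a & forall z, z * a = a * z -> z * s = s * z].
Proof.
move=> pa; have [K0|K0] := eqVneq (nrm a) 0.
  exists 0; split; first exact: uc_star0.
    by rewrite mul0r (uc_norm_eq0 H K0).
  by move=> z _; rewrite mul0r mulr0.
set K := nrm a in K0 *; have Kp : 0 < K by rewrite lt_def K0 uc_norm_ge0.
pose e := 1 - K^-1%:C *: a.
have eE : e = K^-1%:C *: (K%:C%:A - a).
  by rewrite scalerBr scalerA -rmorphM mulVf // scale1r.
have se : st e = e by rewrite uc_starB uc_star1 starZ conj_realC (proj1 pa).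
have ne : nrm e <= 1.
  rewrite eE (uc_normZ H) cabs_real ger0_norm ?invr_ge0 ?(ltW Kp) //.
  by rewrite ler_pdivrMl // mulr1 upos_norm.
have [g [sg gg gc]] := uc_sqrt se ne.
exists ((Num.sqrt K)%:C *: g); split.
- by rewrite starZ conj_realC sg.
- rewrite -scalerAl -scalerAr scalerA -rmorphM -expr2 sqr_sqrtr ?(ltW Kp) //.
  by rewrite gg /e opprB addrC subrK scalerA -rmorphM mulfV // scale1r.
- move=> z za; rewrite -scalerAl -scalerAr gc // mulrBr mulrBl mulr1 mul1r.
  by rewrite -scalerAl -scalerAr za.
Qed.

(** The roots s of a and u of b commute, so a b = (s u)^2 with s u self-adjoint. *)
Lemma uposM a b : upos a -> upos b -> a * b = b * a -> upos (a * b).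
Proof.
move=> pa pb ab; have [s [ss sE sc]] := upos_sqrt pa.
have [u [su uE uc]] := upos_sqrt pb.
have us : s * u = u * s by apply: uc; apply/esym/sc.
have -> : a * b = (s * u) * (s * u).
  by rewrite -sE -uE -[RHS]mulrA (mulrA u s) -us !mulrA.
by apply: upos_sq; rewrite starM ss su.
Qed.

Lemma upos_real (r : R) : 0 <= r -> upos r%:C%:A.
Proof.
move=> r0; apply: (@upos_near _ r); first exact: uc_starR.
by rewrite subrr uc_norm0.
Qed.

Lemma uposZ (r : R) a : 0 <= r -> upos a -> upos (r%:C *: a).
Proof.
move=> r0 pa; rewrite -[X in upos (_ *: X)]mul1r scalerAl.
by apply: uposM => //; [exact: upos_real|rewrite -scalerAl -scalerAr mul1r mulr1].
Qed.

Lemma upos_adde a : st a = a ->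
  (forall e : R, 0 < e -> upos (a + e%:C%:A)) -> upos a.
Proof.
move=> sa pae; split=> // z az; have zE := sp_real sa az.
rewrite zE ler0c; apply/ler_addgt0Pr => e e0; rewrite addrC -ler0c.
have [_] := pae e e0; apply; apply: contra_not az; rewrite zE.
by rewrite rmorphD /= scalerDl opprD addrA addrK.
Qed.

Lemma upos_norm_sub a : st a = a -> upos ((nrm a)%:C%:A - a).
Proof.
move=> sa; have sra : st ((nrm a)%:C%:A - a) = (nrm a)%:C%:A - a.
  by rewrite uc_starB uc_starR sa.
split=> // z rz; have zE := sp_real sra rz.
have := sp_norm (sp_subr rz); rewrite zE -rmorphB ler0c cabs_real.
by move/(le_trans (ler_norm _)); rewrite gerBl.
Qed.

(** |b| - a = (|b| - b) + (b - a) is positive, which confines the spectrum of a to [0, |b|]. *)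
Lemma uc_norm_le a b : upos a -> upos (b - a) -> nrm a <= nrm b.
Proof.
move=> pa pba; have sb : st b = b.
  by rewrite -(subrK a b) starD (proj1 pba) (proj1 pa).
have pb : upos ((nrm b)%:C%:A - a).
  by rewrite -(subrK b (_%:A)) -addrA; apply: uposD pba; apply: upos_norm_sub.
apply: uc_norm_spectral; [exact: (proj1 pa)|exact: uc_norm_ge0|move=> z az].
have zE := sp_real (proj1 pa) az; have z0 := proj2 pa _ az.
have : sp ((nrm b)%:C%:A - a) ((nrm b)%:C - z).
  by apply: sp_subr; rewrite opprB addrC subrK.
move=> /(proj2 pb); move: z0; rewrite zE -rmorphB !ler0c subr_ge0 => z0 zb.
by rewrite cabs_real ger0_norm.
Qed.

(** Here u and v are the real and imaginary parts of a; commutativity turns a^* a into u^2 + v^2. *)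
Lemma upos_starM a : (forall x y : B, x * y = y * x) -> upos (st a * a).
Proof.
move=> comm; pose h : R[i] := (2^-1)%:C.
pose u := h *: (a + st a); pose v := (h * 'i%R) *: (st a - a).
have su : st u = u by rewrite starZ conj_realC starD starK addrC.
have sv : st v = v.
  rewrite starZ rmorphM /= conj_realC conjCi uc_starB starK mulrN scaleNr -scalerN.
  by rewrite opprB.
have -> : st a * a = u * u + v * v; last by apply: uposD; apply: upos_sq.
rewrite -!scalerAl -!scalerAr !scalerA mulrACA -(expr2 'i%R) sqrCi mulrN1 scaleNr.
rewrite -scalerBr.
have -> : (a + st a) * (a + st a) - (st a - a) * (st a - a) = 4%:R *: (st a * a).
  transitivity ((a + a) * (st a + st a)); last first.
    by rewrite -!mulr2n mulrnAl mulrnAr -mulrnA comm scaler_nat.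
  have -> : a + a = (a + st a) - (st a - a) by rewrite opprB addrACA subrr addr0.
  have -> : st a + st a = (a + st a) + (st a - a).
    by rewrite [st a - a]addrC addrACA subrr add0r.
  move: (a + st a) (st a - a) => p q.
  by rewrite mulrBl !mulrDr (comm q p) opprD addrA addrK.
rewrite scalerA -rmorphM (_ : _ * 4%:R = 1) ?scale1r //.
by rewrite -[4%:R](rmorph_nat (real_complex R)) -rmorphM /= (_ : _ * _ = 1) //; lra.
Qed.

End UnitalCstar.

Arguments upos {R B} st a.

(** * Polynomial approximation *)

Section Bernstein.

(* De Casteljau form: moments follow by induction on n, without binomials. *)
Fixpoint bernstein (K : pzRingType) n (f : nat -> K) (x : K) : K :=
  if n is m.+1 then
    x * bernstein m (f \o succn) x + (1 - x) * bernstein m f x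
  else f 0%N.

Fixpoint bernstein_poly (K : nzRingType) n (f : nat -> K) : {poly K} :=
  if n is m.+1 then
    'X * bernstein_poly m (f \o succn) + (1 - 'X) * bernstein_poly m f
  else (f 0%N)%:P.

Lemma horner_bernstein (K : comNzRingType) n (f : nat -> K) x :
  (bernstein_poly n f).[x] = bernstein n f x.
Proof.
elim: n f => [|n IH] f /=; first by rewrite hornerC.
by rewrite !hornerE !IH.
Qed.

Lemma bernsteinB (K : comNzRingType) n (f : nat -> K) (c x : K) :
  bernstein n (fun k => f k - c) x = bernstein n f x - c.
Proof. by elim: n f => [//|n IH] f /=; rewrite !IH; ring. Qed.

Lemma bernstein_affine (K : comNzRingType) n (f : nat -> K) (c d x : K) :
  bernstein n (fun k => c + d * f k) x = c + d * bernstein n f x.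
Proof. by elim: n f => [//|n IH] f /=; rewrite !IH; ring. Qed.

(** For a binomial variable X with n trials of probability x this is E(X - a)^2, squared bias plus
    variance. The centre a is left free because the induction moves it to a - 1. *)
Lemma bernstein_sq (K : comNzRingType) n (a x : K) :
  bernstein n (fun k => (k%:R - a) ^+ 2) x =
  (n%:R * x - a) ^+ 2 + n%:R * (x * (1 - x)).
Proof.
elim: n a => [|n IH] a /=; first by rewrite !mul0r addr0.
rewrite IH (_ : _ \o _ = fun k => (k%:R - (a - 1)) ^+ 2); last first.
  by apply/funext => k /=; rewrite -natr1; congr (_ ^+ 2); ring.
by rewrite IH -natr1; ring.
Qed.

Lemma bernstein_le (K : numDomainType) n (f g : nat -> K) x : 0 <= x <= 1 ->
  (forall k, f k <= g k) -> bernstein n f x <= bernstein n g x.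
Proof.
move=> x01; have /andP[x0 x1] := x01.
elim: n f g => [//|n IH] f g fg /=; first exact: fg.
by rewrite lerD // ler_wpM2l ?subr_ge0 ?IH // => k; apply: fg.
Qed.

Lemma cabs_bernstein (R : realType) n (f : nat -> R[i]) (x : R) : 0 <= x <= 1 ->
  cabs (bernstein n f x%:C) <= bernstein n (fun k => cabs (f k)) x.
Proof.
move=> /andP[x0 x1]; elim: n f => [//|n IH] f /=.
rewrite (le_trans (cabsD _ _)) // !cabsM -(rmorph1 (real_complex R)) -rmorphB.
rewrite !cabs_real ger0_norm // ger0_norm ?subr_ge0 //.
by rewrite lerD // ler_wpM2l ?subr_ge0 // (le_trans (IH _)).
Qed.

End Bernstein.

Section Weierstrass.
Context {R : realType}.
Implicit Types (Y : set R) (f : R -> R[i]).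

Definition pointwise_continuous Y f : Prop :=
  forall x, Y x -> forall e : R, 0 < e ->
  exists2 d : R, 0 < d & forall y, Y y -> `|y - x| < d -> cabs (f y - f x) <= e.

(** Heine-Cantor through the near-covering form of compactness: a radius d obtained at x serves
    every y within d/2 of x, for increments below d/2. *)
Lemma compact_uniform Y f : compact Y -> pointwise_continuous Y f ->
  forall e : R, 0 < e -> exists2 d : R, 0 < d &
  forall x y, Y x -> Y y -> `|y - x| < d -> cabs (f y - f x) <= e.
Proof.
move=> /compact_near_coveringP cY fY e e0.
pose P (d : R) x := Y x -> forall y, Y y -> `|y - x| < d -> cabs (f y - f x) <= e.
have := cY R (0^'+) P _; case.
  move=> x Yx; have e20 : 0 < e / 2 by rewrite divr_gt0.
  have [d d0 fd] := fY x Yx _ e20.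
  have d20 : 0 < d / 2 by rewrite divr_gt0.
  exists ([set y | `|x - y| < d / 2], [set r | 0 < r < d / 2]) => /=.
    split; first by apply/nbhs_ballP; exists (d / 2).
    by near=> r; apply/andP; split; near: r;
      [exact: nbhs_right_gt|exact: nbhs_right_lt].
  move=> [y r] /= [xy /andP[r0 rd]] Yy z Yz zy.
  have -> : f z - f y = (f z - f x) + - (f y - f x) by rewrite opprB addrA subrK.
  rewrite (splitr e) (le_trans (cabsD _ _)) // cabsN lerD // fd //.
    rewrite (_ : z - x = (z - y) - (x - y)); last by ring.
    by rewrite (splitr d) (le_lt_trans (ler_normB _ _)) // ltrD // (lt_trans zy).
  by rewrite distrC (lt_trans xy) // ltr_pdivrMr // mulr_natr mulr2n ltrDl.
move=> d /= d0 Pd; exists (d / 2); first by rewrite divr_gt0.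
move=> x y Yx Yy xy; apply: (Pd (d / 2)) => //=.
  by rewrite sub0r normrN gtr0_norm ?divr_gt0 // ltr_pdivrMr // mulr_natr mulr2n ltrDl.
by rewrite divr_gt0.
Unshelve. all: end_near. Qed.

Lemma compact_cabs_bounded Y f : compact Y -> pointwise_continuous Y f ->
  exists2 S : R, 0 <= S & forall x, Y x -> cabs (f x) <= S.
Proof.
move=> /compact_near_coveringP cY fY.
pose P (S : R) x := Y x -> cabs (f x) <= S.
have := cY R +oo P _; case.
  move=> x Yx; have [d d0 fd] := fY x Yx _ ltr01.
  exists ([set y | `|x - y| < d], [set S | 1 + cabs (f x) < S]) => /=.
    split; first by apply/nbhs_ballP; exists d.
    by exists (1 + cabs (f x)); split => //; apply: num_real.
  move=> [y S] /= [xy xS] Yy; rewrite -(subrK (f x) (f y)).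
  rewrite (le_trans (cabsD _ _)) // (le_trans _ (ltW xS)) // lerD // fd //.
  by rewrite distrC.
move=> M [Mr PM]; exists (Num.max 0 (M + 1)); first by rewrite le_max lexx.
by move=> x Yx; rewrite le_max (PM (M + 1)) ?orbT // ltrDl.
Qed.

(* The Bernstein nodes take values of f at nearby points of Y, so that f need
   not be extended to the whole interval. *)
Lemma weierstrass Y f (M : R) : compact Y -> (forall x, Y x -> 0 <= x <= M) ->
  0 < M -> pointwise_continuous Y f ->
  forall e : R, 0 < e -> exists p : {poly R[i]},
  forall x, Y x -> cabs (p.[x%:C] - f x) <= e.
Proof.
move=> cY YM M0 fY e e0.
have e20 : 0 < e / 2 by rewrite divr_gt0.
have [d d0 fd] := compact_uniform cY fY e20.
have [S S0 fS] := compact_cabs_bounded cY fY.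
(* Two points of Y that, divided by M, lie within dl of the same node are at most 2d/3 apart. *)
pose dl := d / (M *+ 3); have dl0 : 0 < dl by rewrite divr_gt0 // pmulrn_rgt0.
(* This makes 2S/(dl^2 n), the contribution of the far nodes, at most e/2. *)
pose n := (Num.truncn (4 * S / (dl ^+ 2 * e))).+1.
have n0 : 0 < n%:R :> R by rewrite ltr0n.
have nS : 4 * S / (dl ^+ 2 * e) <= n%:R by rewrite ltW // truncnS_gt.
pose near_node k x := Y x /\ `|x / M - k%:R / n%:R| <= dl.
(* A node without nearby points of Y gets the value 0; it is then farther than dl from x/M for every
   x in Y, and only |c k| <= S matters. *)
pose c k : R[i] := if pselect (exists x, near_node k x) is left ex
                   then f (projT1 (cid ex)) else 0.
have cS k : cabs (c k) <= S.
  rewrite /c; case: pselect => [ex|_]; last by rewrite cabs0.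
  by case: cid => y [Yy _] /=; apply: fS.
exists (bernstein_poly n c \Po (M^-1%:C *: 'X)) => x Yx.
have /andP[x0 xM] := YM x Yx.
rewrite horner_comp hornerZ hornerX -rmorphM horner_bernstein -bernsteinB.
set y := M^-1 * x.
have y01 : 0 <= y <= 1.
  by rewrite mulr_ge0 ?invr_ge0 ?(ltW M0) //= ler_pdivrMl // mulr1.
apply: (le_trans (cabs_bernstein _ _ y01)).
pose q := 2 * S / (n%:R * dl) ^+ 2.
have nd0 : 0 < n%:R * dl by rewrite mulr_gt0.
have q0 : 0 <= q by rewrite divr_ge0 ?sqr_ge0 // mulr_ge0.
(* Chebyshev's argument: near nodes are handled by uniform continuity, and at far ones 2S <= q (k -
   n y)^2, whose Bernstein mean is q times the variance. *)
have maj k : cabs (c k - f x) <= e / 2 + q * (k%:R - n%:R * y) ^+ 2.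
  have [yk|yk] := leP `|y - k%:R / n%:R| dl.
    rewrite (@le_trans _ _ (e / 2)) ?lerDl ?(mulr_ge0 q0) ?sqr_ge0 //.
    rewrite /c; case: pselect => [ex|[]]; last by exists x; split; rewrite // mulrC.
    case: cid => z [Yz zk] /=; apply: fd => //.
    have -> : z - x = M * ((z / M - k%:R / n%:R) - (y - k%:R / n%:R)).
      by rewrite /y; field; rewrite gt_eqF //= gt_eqF.
    rewrite normrM gtr0_norm // (@le_lt_trans _ _ (M * (dl + dl))) //.
      by rewrite ler_pM2l // (le_trans (ler_normB _ _)) // lerD.
    rewrite (_ : M * (dl + dl) = d * (2 / 3)); first by rewrite gtr_pMr //; lra.
    by rewrite /dl; field; rewrite gt_eqF.
  rewrite (@le_trans _ _ (2 * S)) //.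
    rewrite (le_trans (cabsD _ _)) // cabsN mulr_natl mulr2n lerD //.
    exact: fS.
  have kk : (n%:R * dl) ^+ 2 <= (k%:R - n%:R * y) ^+ 2.
    rewrite -[leRHS]real_normK ?num_real // ler_sqr ?nnegrE ?(ltW nd0) //.
    rewrite (_ : k%:R - n%:R * y = - (n%:R * (y - k%:R / n%:R))); last first.
      by field; rewrite gt_eqF.
    by rewrite normrN normrM gtr0_norm // ler_pM2l // ltW.
  rewrite (@le_trans _ _ (q * (n%:R * dl) ^+ 2)) //.
    by rewrite /q mulfVK // expf_neq0 // gt_eqF.
  by rewrite ler_wpDl ?(ltW e20) // ler_wpM2l.
apply: (le_trans (bernstein_le n y01 maj)).
rewrite bernstein_affine bernstein_sq subrr expr0n add0r [leRHS]splitr lerD2l.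
have /andP[y0 y1] := y01.
have yy : y * (1 - y) <= 1 by nra.
rewrite (@le_trans _ _ (q * n%:R)) //.
  by rewrite ler_wpM2l // ler_piMr // ltW.
have -> : q * n%:R = 2 * S / dl ^+ 2 / n%:R.
  by rewrite /q; field; rewrite !gt_eqF.
rewrite ler_pdivrMr //.
have -> : 2 * S / dl ^+ 2 = e / 2 * (4 * S / (dl ^+ 2 * e)).
  by field; rewrite !gt_eqF.
by rewrite ler_pM2l.
Qed.

End Weierstrass.

(** * Unitization and existence of the functional calculus *)

Section Unitization.
Context {R : realType} (S : starAlgType R).

Lemma amul0r (a : S) : a ** 0 = 0.
Proof. by apply: (addrI (a ** 0)); rewrite -amulDr !addr0. Qed.

Lemma amul0l (a : S) : 0 ** a = 0.
Proof. by apply: (addrI (0 ** a)); rewrite -amulDl !addr0. Qed.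

Definition unitization : Type := (S * R[i]^o)%type.

HB.instance Definition _ := GRing.Lmodule.copy unitization (S * R[i]^o)%type.

Implicit Types u v w : unitization.

Let umul : unitization -> unitization -> unitization := @unitization_mul R S.

Fact umulA : associative umul.
Proof.
move=> [a k] [b l] [c m]; congr pair => /=; last by rewrite mulrA.
rewrite !amulDr !amulDl !amulZl !amulZr !scalerDr !scalerA amulA.
rewrite [m * l]mulrC [k * m]mulrC -!addrA; congr (_ + _).
by rewrite [RHS]addrCA; congr (_ + _); rewrite addrCA; congr (_ + _); rewrite addrCA.
Qed.

Fact umul1l : left_id ((0, 1) : unitization) umul.
Proof.
move=> [b l]; congr pair => /=; last by rewrite mul1r.
by rewrite amul0l scale1r scaler0 add0r addr0.
Qed.

Fact umul1r : right_id ((0, 1) : unitization) umul.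
Proof.
move=> [b l]; congr pair => /=; last by rewrite mulr1.
by rewrite amul0r scale1r scaler0 !add0r.
Qed.

Fact umulDl : left_distributive umul +%R.
Proof.
move=> [a k] [b l] [c m]; congr pair => /=; last by rewrite mulrDl.
rewrite amulDl scalerDr scalerDl -!addrA; congr (_ + _).
by rewrite addrCA; congr (_ + _); rewrite [RHS]addrCA; congr (_ + _); rewrite addrCA.
Qed.

Fact umulDr : right_distributive umul +%R.
Proof.
move=> [a k] [b l] [c m]; congr pair => /=; last by rewrite mulrDr.
rewrite amulDr scalerDr scalerDl -!addrA; congr (_ + _).
by rewrite addrCA; congr (_ + _); rewrite [RHS]addrCA; congr (_ + _); rewrite addrCA.
Qed.

Fact uone_neq0 : ((0, 1) : unitization) != 0.
Proof. by rewrite xpair_eqE oner_eq0 andbF. Qed.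

HB.instance Definition _ := GRing.Zmodule_isNzRing.Build unitization
  umulA umul1l umul1r umulDl umulDr uone_neq0.

Fact uscaleAl (k : R[i]) u v : k *: (u * v) = (k *: u) * v.
Proof.
case: u v => [a l] [b m]; congr pair; last exact: mulrA.
by rewrite /= !scalerDr amulZl !scalerA [k * m]mulrC.
Qed.

HB.instance Definition _ := GRing.Lmodule_isLalgebra.Build R[i] unitization uscaleAl.

Fact uscaleAr (k : R[i]) u v : k *: (u * v) = u * (k *: v).
Proof.
case: u v => [a l] [b m]; congr pair; last exact: mulrCA.
by rewrite /= !scalerDr amulZr !scalerA [k * l]mulrC.
Qed.

HB.instance Definition _ := GRing.Lalgebra_isAlgebra.Build R[i] unitization uscaleAr.

Definition ustar u : unitization := (star u.1, Num.conj u.2).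

Definition uemb (a : S) : unitization := (a, 0).

Lemma uembD a b : uemb (a + b) = uemb a + uemb b.
Proof. by congr pair; rewrite /= addr0. Qed.

Lemma uembN a : uemb (- a) = - uemb a.
Proof. by congr pair; rewrite /= oppr0. Qed.

Lemma uembB a b : uemb (a - b) = uemb a - uemb b.
Proof. by rewrite uembD uembN. Qed.

Lemma uembZ (k : R[i]) a : uemb (k *: a) = k *: uemb a.
Proof. by congr pair; rewrite /= scaler0. Qed.

Lemma uembM a b : uemb (a ** b) = uemb a * uemb b.
Proof. by congr pair; rewrite /= ?scale0r ?addr0 // mulr0. Qed.

Lemma ustar_emb a : ustar (uemb a) = uemb (star a).
Proof. by congr pair; rewrite /= conjC0. Qed.

Lemma uemb_inj : injective uemb.
Proof. by move=> a b []. Qed.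

Lemma uscaleE (k : R[i]) : k%:A = ((0, k) : unitization).
Proof. by congr pair; [exact: scaler0|exact: mulr1]. Qed.

Lemma unitizationE u : u = uemb u.1 + u.2%:A.
Proof. by case: u => a k; rewrite uscaleE; congr pair; rewrite /= ?addr0 ?add0r. Qed.

Lemma spectrumE a : spectrum a = sp (uemb a).
Proof.
apply/funext => z; rewrite /spectrum /sp /=.
have -> : (a, - z) = uemb a - z%:A :> unitization.
  by rewrite uscaleE; congr pair; rewrite /= ?oppr0 ?addr0 ?add0r.
by [].
Qed.

(** The copy of S is a proper ideal, so its elements are never invertible. This provides the
    spectral point asked for by [sp_horner]. *)
Lemma sp_emb0 a : sp (uemb a) 0.
Proof.
rewrite /sp /= scale0r subr0 => -[[b k] [/(congr1 snd)/eqP]].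
by rewrite /= mul0r eq_sym oner_eq0.
Qed.

Lemma sp_snd u : sp u u.2.
Proof. by have := @sp_emb0 u.1; rewrite /sp /= scale0r subr0 {2}[u]unitizationE addrK. Qed.

Lemma positiveE (a : S) : positive a <-> upos ustar (uemb a).
Proof.
rewrite /positive /upos ustar_emb spectrumE; split=> -[sa pa]; split=> //.
  by rewrite sa.
exact: uemb_inj.
Qed.

Lemma horner_emb_snd a (p : {poly R[i]}) : (horner_alg (uemb a) p).2 = p.[0].
Proof.
elim/poly_ind: p => [|p k IH]; first by rewrite raddf0 horner0.
rewrite rmorphD rmorphM /= horner_algX horner_algC uscaleE /=.
by rewrite mulr0 add0r !hornerE.
Qed.

Lemma umul_comm : commutative (@amul R S) -> forall u v, u * v = v * u.
Proof.
move=> comS [a k] [b l]; congr pair; last exact: mulrC.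
by rewrite /= comS addrAC.
Qed.

End Unitization.

Arguments ustar {R S}.
Arguments uemb {R S}.

Section CalculusExists.
Context {R : realType} {S : starAlgType R} {nrm : unitization S -> R}.
Hypothesis H : ucstar (@ustar R S) nrm.
Context (a : S) (pa : positive a).
Implicit Types (f g : R[i] -> R[i]) (x y : S) (p q : {poly R[i]}).

Let sa : ustar (uemb a) = uemb a.
Proof. by rewrite ustar_emb (proj1 pa). Qed.

Let real_part : set R := [set x | spectrum a x%:C].

Let spec_real z : spectrum a z -> z = (complex.Re z)%:C.
Proof. by move=> /(proj2 pa)/ge0_ReK. Qed.

Let real_part_itv (x : R) : real_part x -> 0 <= x <= nrm (uemb a) + 1.
Proof.
move=> ax; have := proj2 pa _ ax; rewrite /= ler0c => x0; rewrite x0 /=.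
move: ax; rewrite /real_part /= spectrumE => /(sp_norm H).
by rewrite cabs_real ger0_norm // => /le_trans; apply; rewrite lerDl.
Qed.

Let real_part_compact : compact real_part.
Proof.
apply: (@subclosed_compact _ _ `[0, nrm (uemb a) + 1]%classic).
- move=> x clx; apply: contrapT; rewrite /real_part /= spectrumE => nx.
  have [d d0 dP] := sp_open H nx.
  have /clx[y [yr xy]] : nbhs x (ball x d) by apply: nbhsx_ballx.
  move: yr; rewrite /real_part /= spectrumE; apply: dP.
  by rewrite -rmorphB cabs_real distrC.
- exact: segment_compact.
- by move=> x /real_part_itv; rewrite /= in_itv.
Qed.

Let calculus_fun_continuous f : calculus_fun a f ->
  pointwise_continuous real_part (fun x : R => f x%:C).
Proof.
move=> [_ /subspace_continuousP cf] x ax e e0.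
have ec0 : 0 < e%:C :> R[i] by rewrite ltcR.
have /cvgrPdist_le /(_ _ ec0) := cf _ ax.
rewrite near_withinE => /nbhs_ballP[d /= d0 dP].
have dE : d = (complex.Re d)%:C by apply/ge0_ReK/ltW.
exists (complex.Re d); first by rewrite -ltcR -dE.
move=> y ay xy; rewrite -cabsN opprB cabs_le; apply: dP => //.
by rewrite /ball /= -rmorphB cabsE cabs_real distrC dE ltcR.
Qed.

Definition approximates f (u : unitization S) : Prop :=
  forall e : R, 0 < e -> exists p,
    (forall z, spectrum a z -> cabs (p.[z] - f z) <= e) /\
    nrm (horner_alg (uemb a) p - u) <= e.

Let norm_horner_le p (e : R) : (forall z, spectrum a z -> cabs p.[z] <= e) ->
  nrm (horner_alg (uemb a) p) <= e.
Proof.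
move=> pe; apply: (uc_norm_horner H sa (sp_emb0 (a := a))) => z.
by rewrite -spectrumE; apply: pe.
Qed.

(** Two polynomials close to f on the spectrum are close to each other there, hence so are their
    values at a, by [norm_horner_le]. *)
Lemma approximates_unique f u v : approximates f u -> approximates f v -> u = v.
Proof.
move=> fu fv; apply/eqP; rewrite -subr_eq0; apply/eqP/(uc_norm_eq0 H)/eqP.
rewrite eq_le (uc_norm_ge0 H) andbT; apply/ler_addgt0Pr => e e0; rewrite add0r.
have e40 : 0 < e / 4 by rewrite divr_gt0.
have [p [pf pu]] := fu _ e40; have [q [qf qv]] := fv _ e40.
have pq : nrm (horner_alg (uemb a) (p - q)) <= e / 4 + e / 4.
  apply: norm_horner_le => z az.
  rewrite hornerD hornerN (_ : _ - _ = (p.[z] - f z) - (q.[z] - f z)).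
    by rewrite (le_trans (cabsD _ _)) // cabsN lerD ?pf ?qf.
  by rewrite opprB addrA subrK.
rewrite rmorphB /= in pq.
set P := horner_alg _ p in pu pq; set Q := horner_alg _ q in qv pq.
have -> : u - v = - (P - u) + (P - Q) + (Q - v).
  by rewrite opprB !addrA !subrK.
rewrite (le_trans (uc_normD H _ _)) // (@le_trans _ _ (e / 4 + (e / 4 + e / 4) + e / 4)) //.
  rewrite lerD // (le_trans (uc_normD H _ _)) // lerD //.
  by rewrite (uc_normN H).
lra.
Qed.

(** Weierstrass polynomials have Cauchy values at a by [norm_horner_le]. The limit has no scalar
    part: that of p(a) is p(0), which tends to f(0) = 0. *)
Lemma approximates_exists f : calculus_fun a f -> exists y, approximates f (uemb y).
Proof.
move=> cf; have f0 : f 0 = 0 by case: cf.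
have M0 : 0 < nrm (uemb a) + 1 by rewrite ltr_wpDl // (uc_norm_ge0 H).
have W e (e0 : 0 < e) : exists p, forall z, spectrum a z -> cabs (p.[z] - f z) <= e.
  have [p pf] := weierstrass real_part_compact real_part_itv M0
                   (calculus_fun_continuous cf) e0.
  exists p => z az; have zE := spec_real az; rewrite zE; apply: pf.
  by rewrite /real_part /= -zE.
have n0 n : 0 < n.+1%:R^-1 :> R by rewrite invr_gt0.
have [p pP] := choice (fun n => W _ (n0 n)).
have small (e : R) : 0 < e -> exists N, forall n, (N <= n)%N -> n.+1%:R^-1 <= e.
  move=> e0; exists (Num.truncn e^-1) => n Nn.
  rewrite invf_ple ?posrE // (le_trans (ltW (truncnS_gt _))) //.
  by rewrite ler_nat ltnS.
have [e e0|l pl] := uc_complete H (u := fun n => horner_alg (uemb a) (p n)).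
  have e20 : 0 < e / 2 by rewrite divr_gt0.
  have [N NP] := small _ e20; exists N => m n Nm Nn.
  rewrite -rmorphB; apply: norm_horner_le => z az.
  rewrite hornerD hornerN (_ : _ - _ = ((p m).[z] - f z) - ((p n).[z] - f z)).
    rewrite (splitr e) (le_trans (cabsD _ _)) // cabsN.
    by rewrite lerD // (le_trans (pP _ _ az)) // NP.
  by rewrite opprB addrA subrK.
have lP : approximates f l.
  move=> e e0; have [N NP] := small _ e0.
  have [M MP] := tends_small pl e0.
  exists (p (maxn N M)); split; last by apply: MP; rewrite leq_maxr.
  by move=> z az; rewrite (le_trans (pP _ _ az)) // NP // leq_maxl.
suff l2 : l.2 = 0.
  by exists l.1; rewrite (_ : uemb l.1 = l) // [RHS]unitizationE l2 scale0r addr0.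
apply/cabs_eq0/eqP; rewrite eq_le cabs_ge0 andbT.
apply/ler_addgt0Pr => e e0; rewrite add0r.
have e20 : 0 < e / 2 by rewrite divr_gt0.
have [q [qf ql]] := lP _ e20.
have a0 : spectrum a 0 by rewrite spectrumE; apply: sp_emb0.
have := sp_norm H (@sp_snd _ _ (horner_alg (uemb a) q - l)).
rewrite /= horner_emb_snd => /le_trans /(_ ql) ql2.
have := qf _ a0; rewrite f0 subr0 => q0.
rewrite -[l.2](subKr q.[0]) (splitr e) (le_trans (cabsD _ _)) // cabsN lerD //.
Qed.

Lemma approximates_ext f g u : (forall z, spectrum a z -> f z = g z) ->
  approximates f u -> approximates g u.
Proof.
move=> fg fu e e0; have [p [pf pu]] := fu e e0; exists p; split=> // z az.
by rewrite -fg // pf.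
Qed.

Lemma approximatesD f g u v : approximates f u -> approximates g v ->
  approximates (fun z => f z + g z) (u + v).
Proof.
move=> fu gv e e0; have e20 : 0 < e / 2 by rewrite divr_gt0.
have [p [pf pu]] := fu _ e20; have [q [qg qv]] := gv _ e20.
exists (p + q); split=> [z az|].
  rewrite hornerD opprD addrACA (splitr e) (le_trans (cabsD _ _)) //.
  by rewrite lerD ?pf ?qg.
rewrite rmorphD /= opprD addrACA (splitr e) (le_trans (uc_normD H _ _)) //.
exact: lerD.
Qed.

Lemma approximatesM f g u v (F G : R) : 0 <= F -> 0 <= G ->
  (forall z, spectrum a z -> cabs (f z) <= F) ->
  (forall z, spectrum a z -> cabs (g z) <= G) ->
  approximates f u -> approximates g v -> approximates (fun z => f z * g z) (u * v).
Proof.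
move=> F0 G0 fF gG fu gv e e0.
have nu := uc_norm_ge0 H u; have nv := uc_norm_ge0 H v.
(* With d <= 1 the second factors are bounded by G + 1 and |v| + 1; L dominates both product
   estimates. *)
pose L := F + G + nrm u + nrm v + 1; have L0 : 0 < L by rewrite /L; lra.
pose d := Num.min 1 (e / L).
have d0 : 0 < d by rewrite lt_min ltr01 divr_gt0.
have d1 : d <= 1 by rewrite ge_min lexx.
have dL : d * L <= e by rewrite -ler_pdivlMr // ge_min lexx orbT.
have [p [pf pu]] := fu _ d0; have [q [qg qv]] := gv _ d0.
exists (p * q); split=> [z az|].
  rewrite hornerM (_ : _ - _ = (p.[z] - f z) * q.[z] + f z * (q.[z] - g z)); last by ring.
  rewrite (le_trans (cabsD _ _)) // !cabsM.
  have qG : cabs q.[z] <= G + 1.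
    rewrite -(subrK (g z) q.[z]) (le_trans (cabsD _ _)) // addrC lerD ?gG //.
    exact: le_trans (qg z az) d1.
  rewrite (@le_trans _ _ (d * (G + 1) + F * d)) //.
    by rewrite lerD // ler_pM ?cabs_ge0 ?pf ?qg ?fF.
  by apply: le_trans dL; rewrite /L; nra.
rewrite rmorphM /=; set P := horner_alg _ p in pu *; set Q := horner_alg _ q in qv *.
have -> : P * Q - u * v = (P - u) * Q + u * (Q - v).
  by rewrite mulrBl mulrBr addrA subrK.
rewrite (le_trans (uc_normD H _ _)) //.
have nQ : nrm Q <= nrm v + 1.
  rewrite -(subrK v Q) (le_trans (uc_normD H _ _)) // addrC lerD //.
  exact: le_trans qv d1.
rewrite (@le_trans _ _ (d * (nrm v + 1) + nrm u * d)) //.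
  rewrite lerD // (le_trans (uc_normM H _ _)) //.
    by rewrite ler_pM ?(uc_norm_ge0 H).
  by rewrite ler_wpM2l.
by apply: le_trans dL; rewrite /L; nra.
Qed.

Lemma approximatesZ (k : R[i]) f u : approximates f u ->
  approximates (fun z => k * f z) (k *: u).
Proof.
move=> fu e e0; have k0 : 0 < cabs k + 1 by rewrite ltr_wpDl ?cabs_ge0.
have d0 : 0 < e / (cabs k + 1) by rewrite divr_gt0.
have dk : cabs k * (e / (cabs k + 1)) <= e.
  rewrite mulrCA ler_piMr ?(ltW e0) // ler_pdivrMr // mul1r lerDl //.
have [p [pf pu]] := fu _ d0; exists (k *: p); split=> [z az|].
  rewrite hornerZ -mulrBr cabsM (le_trans _ dk) // ler_wpM2l ?cabs_ge0 ?pf //.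
rewrite linearZ /= mulr_algl -scalerBr (uc_normZ H) (le_trans _ dk) //.
by rewrite ler_wpM2l ?cabs_ge0.
Qed.

Lemma approximates_conj f u : approximates f u ->
  approximates (fun z => Num.conj (f z)) (ustar u).
Proof.
move=> fu e e0; have [p [pf pu]] := fu e e0.
exists (map_poly Num.conj p); split=> [z az|].
  rewrite [in X in X - _](spec_real az) -[X in _.[X]]conj_realC horner_map.
  by rewrite -(spec_real az) -rmorphB cabs_conj pf.
by rewrite -(uc_star_horner H) // -(uc_starB H) (uc_norm_starE H).
Qed.

Lemma approximates_id : approximates id (uemb a).
Proof.
move=> e e0; exists 'X; split=> [z _|].
  by rewrite hornerX subrr cabs0 ltW.
by rewrite horner_algX subrr (uc_norm0 H) ltW.
Qed.

(** [xget] returns a calculus as soon as one exists. The one exhibited sends f to the element it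
    approximates, or to a default 0; each law reduces to the uniqueness of that element. *)
Lemma functional_calculusP : is_functional_calculus a (functional_calculus a).
Proof.
pose phi f : S := if pselect (exists y, approximates f (uemb y)) is left ex
                  then projT1 (cid ex) else 0.
have phiE f y : approximates f (uemb y) -> phi f = y.
  move=> fy; rewrite /phi; case: pselect => [ex|[]]; last by exists y.
  by case: cid => /= x fx; apply/uemb_inj/(approximates_unique fx fy).
have bounded f : calculus_fun a f ->
    exists2 F : R, 0 <= F & forall z, spectrum a z -> cabs (f z) <= F.
  move=> cf; have [F F0 FP] :=
    compact_cabs_bounded real_part_compact (calculus_fun_continuous cf).
  exists F => // z az; rewrite (spec_real az) FP // /real_part /=.
  by rewrite -(spec_real az).
suff phiP : is_functional_calculus a phi.
  exact: (@xgetPex _ (fun=> 0) _ (ex_intro _ phi phiP)).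
split.
- move=> f g cf _ fg; have [y fy] := approximates_exists cf.
  by rewrite (phiE f y fy) (phiE g y) //; apply: approximates_ext fy.
- move=> f g cf cg; have [y fy] := approximates_exists cf.
  have [w gw] := approximates_exists cg.
  rewrite (phiE f y fy) (phiE g w gw); split; apply: phiE.
    by rewrite uembD; apply: approximatesD.
  have [F F0 fF] := bounded _ cf; have [G G0 gG] := bounded _ cg.
  by rewrite uembM; apply: (approximatesM F0 G0).
- move=> k f cf; have [y fy] := approximates_exists cf.
  by rewrite (phiE f y fy); apply: phiE; rewrite uembZ; apply: approximatesZ.
- move=> f cf; have [y fy] := approximates_exists cf.
  by rewrite (phiE f y fy); apply: phiE; rewrite -ustar_emb; apply: approximates_conj.
- exact/phiE/approximates_id.
Qed.

End CalculusExists.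

(** * The norm of the unitization *)

Section RealNorm.
Context {R : realType} {V : normedModType R[i]}.
Implicit Types (v w : V) (k : R[i]).

Definition rnorm v : R := complex.Re `|v|.

Lemma rnormE v : `|v| = (rnorm v)%:C.
Proof. exact: ge0_ReK. Qed.

Lemma rnorm_ge0 v : 0 <= rnorm v.
Proof. by rewrite -ler0c -rnormE. Qed.

Lemma rnormD v w : rnorm (v + w) <= rnorm v + rnorm w.
Proof. by rewrite -lecR rmorphD /= -!rnormE ler_normD. Qed.

Lemma rnormZ k v : rnorm (k *: v) = cabs k * rnorm v.
Proof. by apply: complexI; rewrite rmorphM /= -!rnormE normrZ cabsE. Qed.

Lemma rnormN v : rnorm (- v) = rnorm v.
Proof. by rewrite /rnorm normrN. Qed.

Lemma rnormBC v w : rnorm (v - w) = rnorm (w - v).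
Proof. by rewrite /rnorm distrC. Qed.

Lemma rnorm0 : rnorm 0 = 0.
Proof. by rewrite /rnorm normr0. Qed.

Lemma rnorm_eq0 v : rnorm v = 0 -> v = 0.
Proof. by move=> v0; apply/normr0_eq0; rewrite rnormE v0. Qed.

End RealNorm.

Lemma complex_complete (R : realType) (s : nat -> R[i]) :
  (forall e : R, 0 < e -> exists N, forall m n, (N <= m)%N -> (N <= n)%N ->
     cabs (s m - s n) <= e) ->
  exists l, forall e : R, 0 < e -> exists N, forall n, (N <= n)%N ->
     cabs (s n - l) <= e.
Proof.
move=> cs.
have part (f : R[i] -> R) : (forall z w : R[i], `|f z - f w| <= cabs (z - w)) ->
    exists l : R, forall e : R, 0 < e -> exists N, forall n, (N <= n)%N ->
      `|f (s n) - l| <= e.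
  move=> fle; have : cvgn (f \o s).
    apply/cauchy_cvgP/cauchyP => e e0.
    have e20 : 0 < e / 2 by rewrite divr_gt0.
    have [N NP] := cs _ e20; exists (f (s N)); exists N => // n /= Nn.
    rewrite /ball /= (le_lt_trans (fle _ _)) // (le_lt_trans (NP _ _ _ Nn)) //.
    by rewrite ltr_pdivrMr // mulr_natr mulr2n ltrDl.
  move=> /cvg_ex[/= l /cvgrPdist_le sl]; exists l => e e0.
  have [N _ NP] := sl e e0; exists N => n Nn; rewrite distrC.
  exact: NP.
have ci : cabs ('i : R[i]) = 1 by rewrite /cabs complexiE normCi.
have re (z w : R[i]) : `|complex.Re z - complex.Re w| <= cabs (z - w).
  by rewrite -raddfB /= -lecR -cabsE normc_ge_Re.
have im (z w : R[i]) : `|complex.Im z - complex.Im w| <= cabs (z - w).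
  (* Im z = Re(-i z) reduces the imaginary part to the real one. *)
  have -> : complex.Im z - complex.Im w = complex.Re (- ('i * (z - w))).
    by rewrite raddfN /= mulrC ReiNIm opprK; case: z w => [? ?] [? ?].
  by rewrite -[leRHS]mul1r -ci -cabsM -[leRHS]cabsN -lecR -cabsE normc_ge_Re.
have [x xP] := part _ re; have [y yP] := part _ im.
exists (x%:C + 'i * y%:C) => e e0; have e20 : 0 < e / 2 by rewrite divr_gt0.
have [N NP] := xP _ e20; have [M MP] := yP _ e20.
exists (maxn N M) => n; rewrite geq_max => /andP[Nn Mn].
rewrite [s n]complexE opprD addrACA -mulrBr -!rmorphB (splitr e).
rewrite (le_trans (cabsD _ _)) // lerD //; first by rewrite cabs_real NP.
by rewrite cabsM cabs_real ci mul1r MP.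
Qed.

Section UnitizationNorm.
Context {R : realType} {S : starAlgType R} {V : normedModType R[i]}.
Context (act : S -> V -> V).

Definition uact (u : unitization S) v : V := act u.1 v + u.2 *: v.

(* What makes the operator norm a complete C*-norm: applied to S acting on itself
   and to the adjointable operators acting on their Hilbert module. *)
Record cstar_action : Prop := CstarAction {
  actDl : forall a b v, act (a + b) v = act a v + act b v;
  actZl : forall k a v, act (k *: a) v = k *: act a v;
  actP : forall a k v w, act a (k *: v + w) = k *: act a v + act a w;
  actM : forall a b v, act (a ** b) v = act a (act b v);
  act_bounded : forall a, exists M, forall v, rnorm (act a v) <= M * rnorm v;
  act_inj : forall a, (forall v, act a v = 0) -> a = 0;
  act_star : forall u v,
    rnorm (uact u v) ^+ 2 <= rnorm (uact (ustar u) (uact u v)) * rnorm v;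
  act_complete : forall s : nat -> S,
    (forall e : R, 0 < e -> exists N, forall m n, (N <= m)%N -> (N <= n)%N ->
       forall v, rnorm (act (s m - s n) v) <= e * rnorm v) ->
    exists l, forall e : R, 0 < e -> exists N, forall n, (N <= n)%N ->
       forall v, rnorm (act (s n - l) v) <= e * rnorm v
}.

Hypothesis Hact : cstar_action.
Implicit Types (u : unitization S) (v w : V).

Definition opbound u : set R := [set M |
  [/\ 0 <= M, cabs u.2 <= M & forall v, rnorm (uact u v) <= M * rnorm v]].

(* The maximum of the operator norm and of the norm of the scalar part; the
   latter is needed if S already has a unit. *)
Definition unorm u : R := inf (opbound u).

Let opbound_has_inf u : has_inf (opbound u).
Proof.
split; last by exists 0 => M [].
have [M aM] := act_bounded Hact u.1; have u2 := cabs_ge0 u.2.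
exists (`|M| + cabs u.2); split; first by rewrite addr_ge0.
  by rewrite lerDr.
move=> v; rewrite (le_trans (rnormD _ _)) // rnormZ mulrDl lerD2r.
by rewrite (le_trans (aM v)) // ler_wpM2r ?rnorm_ge0 // ler_norm.
Qed.

Let unorm_le u (M : R) : opbound u M -> unorm u <= M.
Proof. by move=> uM; apply: ge_inf => //; case: (opbound_has_inf u). Qed.

Let unorm_ge0 u : 0 <= unorm u.
Proof. by apply: lb_le_inf => [|M []//]; case: (opbound_has_inf u). Qed.

Let act0r a : act a 0 = 0.
Proof.
by have := actP Hact a (-1) 0 0; rewrite !scaleN1r addr0 oppr0 addNr.
Qed.

Let act0l v : act 0 v = 0.
Proof. by have := actZl Hact 0 0 v; rewrite !scale0r. Qed.

Let uact0 u : uact u 0 = 0.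
Proof. by rewrite /uact act0r scaler0 addr0. Qed.

Lemma unorm_uact u v : rnorm (uact u v) <= unorm u * rnorm v.
Proof.
have [v0|v0] := eqVneq (rnorm v) 0.
  by rewrite (rnorm_eq0 v0) uact0 rnorm0 mulr0.
have vp : 0 < rnorm v by rewrite lt_def v0 rnorm_ge0.
rewrite -ler_pdivrMr //; apply: lb_le_inf => [|M [_ _ uM]].
  by case: (opbound_has_inf u).
by rewrite ler_pdivrMr.
Qed.

Lemma unorm_snd u : cabs u.2 <= unorm u.
Proof. by apply: lb_le_inf => [|M []//]; case: (opbound_has_inf u). Qed.

Lemma uactDl u1 u2 v : uact (u1 + u2) v = uact u1 v + uact u2 v.
Proof. by rewrite /uact (actDl Hact) scalerDl addrACA. Qed.

Lemma uactZl k u v : uact (k *: u) v = k *: uact u v.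
Proof. by rewrite /uact (actZl Hact) scalerDr scalerA. Qed.

Lemma uactM u1 u2 v : uact (u1 * u2) v = uact u1 (uact u2 v).
Proof.
rewrite /uact /= !(actDl Hact) !(actZl Hact) (actM Hact).
rewrite [act u2.1 v + _]addrC (actP Hact) scalerDr scalerA -!addrA.
by rewrite [RHS]addrCA; congr (_ + _); rewrite addrC -addrA.
Qed.

Lemma unorm_ucstar : ucstar (@ustar R S) unorm.
Proof.
have unormM u1 u2 : unorm (u1 * u2) <= unorm u1 * unorm u2.
  apply: unorm_le; split; first by rewrite mulr_ge0.
    by rewrite /= cabsM ler_pM ?cabs_ge0 ?unorm_snd.
  move=> v; rewrite uactM (le_trans (unorm_uact _ _)) // -mulrA.
  by rewrite ler_wpM2l ?unorm_uact.
have unormZ_le k u : unorm (k *: u) <= cabs k * unorm u.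
  apply: unorm_le; split; first by rewrite mulr_ge0 ?cabs_ge0.
    by rewrite /= cabsM ler_wpM2l ?cabs_ge0 ?unorm_snd.
  by move=> v; rewrite uactZl rnormZ -mulrA ler_wpM2l ?cabs_ge0 ?unorm_uact.
split.
- by move=> [a k]; rewrite /ustar /= starK conjCK.
- by move=> u w; congr pair; rewrite /= ?starD ?rmorphD.
- by move=> k u; congr pair; rewrite /= ?starZ ?rmorphM.
- move=> u w; congr pair; last by rewrite /= rmorphM mulrC.
  by rewrite /= !starD !starZ starM addrAC.
- apply/eqP; rewrite eq_le; apply/andP; split.
    apply: unorm_le; split=> //; first by rewrite /= cabs1.
    move=> v; by rewrite /uact /= scale1r act0l add0r mul1r.
  by rewrite -[X in X <= _](@cabs1 R) (unorm_snd 1).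
- move=> [a k] ak0; have k0 : k = 0.
    apply/cabs_eq0/eqP; rewrite eq_le cabs_ge0 andbT -ak0.
    exact: (unorm_snd (a, k)).
  congr pair => //; apply: (act_inj Hact) => v; apply/rnorm_eq0/eqP.
  rewrite eq_le rnorm_ge0 andbT; have := unorm_uact (a, k) v.
  by rewrite ak0 mul0r /uact /= k0 scale0r addr0.
- move=> u w; apply: unorm_le; split; first by rewrite addr_ge0.
    by rewrite (le_trans (cabsD _ _)) // lerD ?unorm_snd.
  move=> v; rewrite uactDl (le_trans (rnormD _ _)) // mulrDl.
  by rewrite lerD ?unorm_uact.
(* The reverse inequality is the same one for the scalar k^-1 and the element k u. *)
- move=> k u; apply/eqP; rewrite eq_le unormZ_le /=.
  have [->|k0] := eqVneq k 0; first by rewrite cabs0 mul0r.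
  have ck : cabs k * cabs k^-1 = 1 by rewrite -cabsM mulfV // cabs1.
  rewrite -{1}[u]scale1r -(mulVf k0) -scalerA.
  rewrite (le_trans (ler_wpM2l (cabs_ge0 k) (unormZ_le _ _))) //.
  by rewrite mulrA ck mul1r.
- exact: unormM.
(* The square root of |u^* u| is a bound for u in the sense of [opbound]: for the scalar part k
   because u^* u has scalar part conj(k) k, for the action by [act_star]. *)
- move=> u; have n0 := unorm_ge0 (ustar u * u).
  rewrite -(sqr_sqrtr n0) ler_sqr ?nnegrE ?sqrtr_ge0 //.
  apply: unorm_le; split; first exact: sqrtr_ge0.
    rewrite -ler_sqr ?nnegrE ?sqrtr_ge0 ?cabs_ge0 // sqr_sqrtr //.
    rewrite (le_trans _ (unorm_snd (ustar u * u))) //.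
    by rewrite /= cabsM cabs_conj expr2.
  move=> v; rewrite -ler_sqr ?nnegrE ?mulr_ge0 ?sqrtr_ge0 ?rnorm_ge0 //.
  rewrite exprMn sqr_sqrtr // (le_trans (act_star Hact u v)) // -uactM expr2 mulrA.
  by rewrite ler_wpM2r ?rnorm_ge0 ?unorm_uact.
(* Scalar parts converge because [unorm] dominates them; once they are subtracted, the action of the
   S-parts is still Cauchy, so [act_complete] applies. *)
- move=> s cs.
  have [k kP] : exists k, forall e : R, 0 < e -> exists N, forall n, (N <= n)%N ->
      cabs ((s n).2 - k) <= e.
    apply: complex_complete => e e0; have [N NP] := cs e e0.
    exists N => m n Nm Nn; rewrite (le_trans _ (NP m n Nm Nn)) //.
    exact: (unorm_snd (s m - s n)).
  have actE u v : act u.1 v = uact u v - u.2 *: v by rewrite addrK.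
  have [l lP] : exists l, forall e : R, 0 < e -> exists N, forall n, (N <= n)%N ->
      forall v, rnorm (act ((s n).1 - l) v) <= e * rnorm v.
    apply: (act_complete Hact) => e e0; have e20 : 0 < e / 2 by rewrite divr_gt0.
    have [N NP] := cs _ e20; exists N => m n Nm Nn v.
    have Nmn := NP m n Nm Nn; rewrite (actE (s m - s n)) (splitr e) mulrDl.
    rewrite (le_trans (rnormD _ _)) // rnormN rnormZ lerD //.
      by rewrite (le_trans (unorm_uact _ _)) // ler_wpM2r ?rnorm_ge0.
    rewrite ler_wpM2r ?rnorm_ge0 // (le_trans _ Nmn) //.
    exact: (unorm_snd (s m - s n)).
  exists (l, k); apply/cvgr0Pnorm_le => e e0.
  have e20 : 0 < e / 2 by rewrite divr_gt0.
  have [N NP] := kP _ e20; have [M MP] := lP _ e20.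
  exists (maxn N M) => // n /=; rewrite geq_max => /andP[Nn Mn].
  rewrite ger0_norm //; apply: unorm_le; split; first exact: ltW.
    rewrite (le_trans (NP _ Nn)) // ler_pdivrMr // mulr_natr mulr2n lerDl.
    exact: ltW.
  move=> v; rewrite /uact (le_trans (rnormD _ _)) // (splitr e) mulrDl lerD ?MP //.
  by rewrite rnormZ ler_wpM2r ?rnorm_ge0 ?NP.
Qed.

End UnitizationNorm.

Lemma starB (R : realType) (S : starAlgType R) (a b : S) :
  star (a - b) = star a - star b.
Proof. by rewrite -scaleN1r starD starZ rmorphN rmorph1 scaleN1r. Qed.

Lemma rnorm_complete (R : realType) (V : completeNormedModType R[i])
    (s : nat -> V) :
  (forall e : R, 0 < e -> exists N, forall m n, (N <= m)%N -> (N <= n)%N ->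
     rnorm (s m - s n) <= e) ->
  exists l, forall e : R, 0 < e -> exists N, forall n, (N <= n)%N ->
     rnorm (s n - l) <= e.
Proof.
move=> cs; have : cvgn s.
  apply/cauchy_cvgP/cauchyP => e e0.
  have eE : e = (complex.Re e)%:C by apply/ge0_ReK/ltW.
  have e20 : 0 < complex.Re e / 2 by rewrite divr_gt0 // -ltcR -eE.
  have [N NP] := cs _ e20; exists (s N); exists N => // n /= Nn.
  rewrite -ball_normE /ball_ /= rnormE eE ltcR (le_lt_trans (NP _ _ _ Nn)) //.
  by rewrite ltr_pdivrMr // mulr_natr mulr2n ltrDl -ltcR -eE.
move=> /cvg_ex[/= l /cvgrPdist_le sl]; exists l => e e0.
have ec0 : 0 < e%:C :> R[i] by rewrite ltcR.
have [N _ NP] := sl _ ec0; exists N => n Nn.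
by rewrite rnormBC -lecR -rnormE; apply: NP.
Qed.

(** * The algebra acting on itself by left multiplication *)

Section SelfAction.
Context {R : realType} {A : cstarAlgType R}.
Implicit Types (a b : A).

Lemma rnormM a b : rnorm (a ** b) <= rnorm a * rnorm b.
Proof. by rewrite -lecR rmorphM /= -!rnormE cstar_normM. Qed.

Lemma rnorm_starM a : rnorm (star a ** a) = rnorm a ^+ 2.
Proof. by apply: complexI; rewrite rmorphXn /= -!rnormE cstar_norm_star. Qed.

Lemma rnorm_star a : rnorm (star a) = rnorm a.
Proof.
suff le b : rnorm b <= rnorm (star b).
  by apply/eqP; rewrite eq_le le -{2}[a]starK le.
have [b0|b0] := eqVneq (rnorm b) 0; first by rewrite b0 rnorm_ge0.
have bp : 0 < rnorm b by rewrite lt_def b0 rnorm_ge0.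
by rewrite -(ler_pM2r bp) -expr2 -rnorm_starM rnormM.
Qed.

Lemma rnorm_Mstar a : rnorm (a ** star a) = rnorm a ^+ 2.
Proof. by rewrite -{1}[a]starK rnorm_starM rnorm_star. Qed.

(** Injectivity and completeness come from testing on the star of the element, since |a a^*| =
    |a|^2; the C*-inequality comes from w^* w = v^* u^* w for w = u v. *)
Lemma self_cstar_action : cstar_action (@amul R A).
Proof.
split.
- exact: amulDl.
- exact: amulZl.
- by move=> a k v w; rewrite amulDr amulZr.
- by move=> a b v; rewrite amulA.
- by move=> a; exists (rnorm a) => v; apply: rnormM.
- move=> a a0; apply/rnorm_eq0/eqP.
  by rewrite -(sqrf_eq0 (rnorm a)) -rnorm_Mstar a0 rnorm0.
- move=> u v; set w := uact _ u v; rewrite -rnorm_starM.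
  have -> : star w ** w = star v ** uact (@amul R A) (ustar u) w.
    have -> : star w = star v ** star u.1 + Num.conj u.2 *: star v.
      by rewrite /w /uact starD starM starZ.
    by rewrite amulDl amulZl -amulA -amulZr -amulDr.
  by rewrite (le_trans (rnormM _ _)) // rnorm_star mulrC.
- move=> s cs; have [e e0|l lP] := rnorm_complete (s := s).
    have [N NP] := cs e e0; exists N => m n Nm Nn.
    have [d0|d0] := eqVneq (rnorm (s m - s n)) 0; first by rewrite d0 ltW.
    have dp : 0 < rnorm (s m - s n) by rewrite lt_def d0 rnorm_ge0.
    rewrite -(ler_pM2r dp) -expr2 -rnorm_Mstar.
    by rewrite (le_trans (NP m n Nm Nn _)) // rnorm_star.
  exists l => e e0; have [N NP] := lP e e0; exists N => n Nn v.
  by rewrite (le_trans (rnormM _ _)) // ler_wpM2r ?rnorm_ge0 ?NP.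
Qed.

Definition cnorm : unitization A -> R := unorm (@amul R A).

Lemma cnorm_ucstar : ucstar (@ustar R A) cnorm.
Proof. exact: unorm_ucstar self_cstar_action. Qed.

(** Testing on the star of a shows that the constructed norm extends the given one. *)
Lemma cnorm_emb a : cnorm (uemb a) = rnorm a.
Proof.
apply/eqP; rewrite eq_le; apply/andP; split.
  apply: ge_inf; first by exists 0 => M [].
  split; rewrite ?rnorm_ge0 //= ?cabs0 ?rnorm_ge0 //.
  by move=> v; rewrite /uact /= scale0r addr0 rnormM.
have [->|a0] := eqVneq (rnorm a) 0; first exact: uc_norm_ge0 cnorm_ucstar _.
have ap : 0 < rnorm a by rewrite lt_def a0 rnorm_ge0.
rewrite -(ler_pM2r ap) -expr2 -rnorm_Mstar -[X in _ <= _ * X]rnorm_star.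
have := unorm_uact self_cstar_action (uemb a) (star a).
by rewrite /uact /= scale0r addr0.
Qed.

End SelfAction.

(** * Adjointable operators as a C*-algebra *)

Section HilbertAction.
Context {R : realType} {A : cstarAlgType R} (comA : commutative (@amul R A)).
Context {E : hilbertModType A}.
Implicit Types (x y z : E) (t : adjointable E).

Let HA := @cnorm_ucstar R A.
Let comU := @umul_comm R A comA.

Lemma rnorm_hilbert x : rnorm x ^+ 2 = rnorm (inner x x).
Proof. by apply: complexI; rewrite rmorphXn /= -!rnormE hilbert_normE sqrtCK. Qed.

Lemma inner_ractl x y a : inner (ract x a) y = star a ** inner x y.
Proof. by rewrite -inner_star inner_ract starM inner_star. Qed.

Lemma innerBl x y z : inner (x - y) z = inner x z - inner y z.
Proof. by rewrite -scaleN1r innerDl innerZl rmorphN rmorph1 scaleN1r. Qed.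

(* With a = <x,y>, n = <x,x> and N = |n|, the element <y,y> - a^* a / N is the
   sum of <xa/N - y, xa/N - y> and of (N - n) a^* a / N^2. *)
Lemma cauchy_schwarz x y : rnorm (inner x y) <= rnorm x * rnorm y.
Proof.
have [x0|x0] := eqVneq x 0.
  by rewrite x0 inner0l rnorm0 mulr_ge0 ?rnorm_ge0.
rewrite -ler_sqr ?nnegrE ?mulr_ge0 ?rnorm_ge0 // exprMn !rnorm_hilbert.
set a := inner x y; set n := inner x x; set m := inner y y; set N := rnorm n.
have N0 : 0 < N.
  rewrite lt_def rnorm_ge0 andbT; apply/eqP => /rnorm_eq0/inner_eq0/eqP.
  by rewrite (negbTE x0).
pose k : R[i] := N^-1%:C; set P := star a ** a.
have zz : inner (ract x (k *: a) - y) (ract x (k *: a) - y) =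
    (k * k) *: (n ** P) - k *: P - (k *: P - m).
  rewrite innerBr !innerBl !inner_ract !inner_ractl starZ conj_realC.
  rewrite !(amulZl, amulZr) scalerA -/n -/a -/m; congr (_ - _ - (_ - _)).
    by rewrite [star a ** n]comA -amulA.
  by rewrite -[inner y x]inner_star.
have zpos : upos ustar (uemb ((k * k) *: (n ** P) - k *: P - (k *: P - m))).
  by rewrite -zz -positiveE; apply: inner_ge0.
have Ppos : upos ustar (uemb P) by rewrite uembM -ustar_emb; apply: (upos_starM HA).
have kk : k * k = (N^-1 * N^-1)%:C by rewrite rmorphM.
have kN : k * k * N%:C = k.
  by rewrite /k -!rmorphM /= mulrC mulrA mulfV ?gt_eqF // mul1r.
have sn : ustar (uemb n) = uemb n by rewrite ustar_emb inner_star.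
have npos : upos ustar ((cnorm (uemb n))%:C%:A - uemb n) by apply: (upos_norm_sub HA).
rewrite cnorm_emb -/N in npos.
have mP : upos ustar (uemb m - uemb (k *: P)).
  have -> : uemb m - uemb (k *: P) =
      uemb ((k * k) *: (n ** P) - k *: P - (k *: P - m)) +
      (k * k) *: ((N%:C%:A - uemb n) * uemb P).
    rewrite mulrBl -scalerAl mul1r scalerBr scalerA kN -uembM -!uembZ.
    rewrite -!uembB -uembD; congr uemb.
    by rewrite [RHS]addrAC [X in _ = X - _]addrA subrK subrr sub0r opprB.
  apply: (uposD HA) zpos _; rewrite kk; apply: (uposZ HA).
    by rewrite mulr_ge0 // invr_ge0 ltW.
  exact: (uposM HA).
have kPpos : upos ustar (uemb (k *: P)).
  by rewrite uembZ; apply: (uposZ HA) => //; rewrite invr_ge0 ltW.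
have := uc_norm_le HA kPpos mP.
rewrite !cnorm_emb rnormZ rnorm_starM cabs_real ger0_norm ?invr_ge0 ?(ltW N0) //.
by rewrite ler_pdivrMl.
Qed.

Lemma adjoint_inner t x y : inner (adjoint t x) y = inner x (t y).
Proof. by rewrite -inner_star -adjointP inner_star. Qed.

Lemma adjointable0 t : t 0 = 0.
Proof.
by have := adjointable_linear t (-1) 0 0; rewrite !scaleN1r addr0 oppr0 addNr.
Qed.

(* Gliding hump (uniform boundedness of the maps <t (y n), _>, which are
   pointwise bounded through the adjoint). *)
Lemma adjointable_bounded t :
  exists M : R, forall x, rnorm (t x) <= M * rnorm x.
Proof.
apply: contrapT => unb.
have large n : exists y, 4 ^+ n * rnorm y < rnorm (t y).
  apply: contrapT => small; apply: unb; exists (4 ^+ n) => x.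
  by rewrite leNgt; apply/negP => xl; apply: small; exists x.
have [y yP] := choice large.
have ty0 n : 0 < rnorm (t (y n)).
  by apply: le_lt_trans (yP n); rewrite mulr_ge0 ?rnorm_ge0 ?exprn_ge0.
pose d n : R := 3^-1 ^+ n.+1; have d0 n : 0 < d n by rewrite exprn_gt0 // invr_gt0.
(* With v = t (y n) and e of length d n along v, <v,e> is half of <v,x+e> - <v,x-e>, so x + e or x -
   e works. *)
have step (nx : nat * E) : exists x', rnorm (x' - nx.2) <= d nx.1 /\
    d nx.1 * rnorm (t (y nx.1)) <= rnorm (inner (t (y nx.1)) x').
  case: nx => n x /=; set v := t (y n).
  have v0 : 0 < rnorm v := ty0 n.
  pose e := (d n / rnorm v)%:C *: v.
  have ne : rnorm e = d n.
    rewrite rnormZ cabs_real ger0_norm ?divr_ge0 ?rnorm_ge0 ?(ltW (d0 n)) //.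
    by rewrite divfK // gt_eqF.
  have ve : rnorm (inner v e) = d n * rnorm v.
    rewrite innerZr rnormZ -rnorm_hilbert cabs_real.
    rewrite ger0_norm ?divr_ge0 ?rnorm_ge0 ?(ltW (d0 n)) // expr2 mulrA.
    by rewrite divfK // gt_eqF.
  have [xe|xe] := leP (rnorm (inner v e)) (rnorm (inner v (x + e))).
    exists (x + e); rewrite -ve; split=> //.
    by rewrite [x + e]addrC addrK ne.
  exists (x - e); rewrite -ve; split.
    by rewrite [x - e]addrC addrK rnormN ne.
  have : rnorm (inner v e + inner v e) <=
         rnorm (inner v (x + e)) + rnorm (inner v (x - e)).
    rewrite -[X in _ <= _ + X]rnormN (le_trans _ (rnormD _ _)) //.
    rewrite innerBr innerDr opprB [inner v x + _]addrC addrACA subrr addr0.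
    exact: lexx.
  rewrite -mulr2n -scaler_nat rnormZ /cabs normr_nat /=.
  lra.
have [next nextP] := choice step.
pose x := fix x n : E := if n is m.+1 then next (m, x m) else 0.
have xS n : rnorm (x n.+1 - x n) <= d n := (nextP (n, x n)).1.
have xv n : d n * rnorm (t (y n)) <= rnorm (inner (t (y n)) (x n.+1)) :=
  (nextP (n, x n)).2.
(* w n is the sum of d k over k >= n, hence bounds the distance from x n to the limit. *)
pose w n : R := 3^-1 ^+ n / 2; have w0 n : 0 < w n by rewrite divr_gt0 // exprn_gt0 // invr_gt0.
have wS n : w n.+1 + d n = w n by rewrite /w /d !exprS; field.
have xw n k : rnorm (x (n + k)%N - x n) <= w n - w (n + k)%N.
  elim: k => [|k IH]; first by rewrite addn0 !subrr rnorm0.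
  have -> : x (n + k.+1)%N - x n = (x (n + k).+1 - x (n + k)%N) + (x (n + k)%N - x n).
    by rewrite addnS addrA subrK.
  have := wS (n + k)%N; rewrite addnS => wk.
  by rewrite (le_trans (rnormD _ _)) // (le_trans (lerD (xS _) IH)) //; lra.
have w_small e : 0 < e -> exists N, forall n, (N <= n)%N -> w n <= e.
  move=> e0; exists (Num.truncn e^-1) => n Nn.
  have : e^-1 <= n.+1%:R by rewrite (le_trans (ltW (truncnS_gt _))) // ler_nat ltnS.
  have n3 : n.+1%:R <= 3 ^+ n :> R.
    elim: n {Nn} => [|n IH]; first by rewrite expr0.
    rewrite exprS -[n.+2%:R]natr1; have : 1 <= n.+1%:R :> R by rewrite ler1n.
    by nra.
  move=> en; rewrite /w exprVn ler_pdivrMr //.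
  rewrite (@le_trans _ _ e) //; last by lra.
  rewrite invf_ple ?posrE ?exprn_gt0 // (le_trans en) //.
have [e e0|l lP] := rnorm_complete (s := x).
  have [N NP] := w_small e e0; exists N => m n.
  wlog mn : m n / (n <= m)%N => [hw Nm Nn|Nm Nn].
    by have [mn|nm] := leqP n m; [|rewrite rnormBC]; apply: hw => //; apply: ltnW.
  rewrite -(subnKC mn) (le_trans (xw _ _)) // (le_trans _ (NP _ Nn)) //.
  by rewrite gerBl ltW.
have lx n : rnorm (l - x n) <= w n.
  apply/ler_addgt0Pr => e e0; have [N NP] := lP e e0.
  have -> : l - x n = (x (n + N)%N - x n) + (l - x (n + N)%N).
    by rewrite [RHS]addrC addrA subrK.
  rewrite (le_trans (rnormD _ _)) // lerD //.
    by rewrite (le_trans (xw _ _)) // gerBl ltW.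
  by rewrite rnormBC NP // leq_addl.
set K := rnorm (adjoint t l).
(* As d n = 2 w n.+1, the later steps undo at most half of the hump: |<t (y n), l>| >= w n.+1 |t (y
   n)|, and w n.+1 4^n = (4/3)^n / 6. *)
have Kn n : 6^-1 * (4 / 3) ^+ n <= K.
  have yn0 : 0 < rnorm (y n).
    rewrite lt_def rnorm_ge0 andbT; apply: contraTneq (ty0 n) => /rnorm_eq0 yn.
    by rewrite yn adjointable0 rnorm0 ltxx.
  rewrite -(ler_pM2r yn0) [K * _]mulrC.
  apply: le_trans (_ : rnorm (inner (t (y n)) l) <= _); last first.
    by rewrite adjointP cauchy_schwarz.
  have -> : inner (t (y n)) l = inner (t (y n)) (x n.+1) - inner (t (y n)) (x n.+1 - l).
    by rewrite innerBr opprB addrC subrK.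
  have tri : rnorm (inner (t (y n)) (x n.+1)) <=
     rnorm (inner (t (y n)) (x n.+1) - inner (t (y n)) (x n.+1 - l)) +
     rnorm (inner (t (y n)) (x n.+1 - l)).
    by rewrite (le_trans _ (rnormD _ _)) // subrK.
  have cs : rnorm (inner (t (y n)) (x n.+1 - l)) <= rnorm (t (y n)) * w n.+1.
    rewrite (le_trans (cauchy_schwarz _ _)) // ler_wpM2l ?rnorm_ge0 //.
    by rewrite rnormBC.
  have dw : d n = 2 * w n.+1 by rewrite /d /w; field.
  have := xv n; rewrite dw => xvn.
  suff : 6^-1 * (4 / 3) ^+ n * rnorm (y n) <= rnorm (t (y n)) * w n.+1 by lra.
  rewrite (_ : 6^-1 * _ * _ = (4 ^+ n * rnorm (y n)) * w n.+1).
    by rewrite ler_pM2r // ltW.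
  by rewrite /w exprS expr_div_n exprVn; field; rewrite expf_neq0.
(* By Bernoulli (4/3)^m >= 1 + m/3, so any m > 18 K makes (4/3)^m / 6 exceed K. *)
pose n := Num.truncn (18 * K).
have : 18 * K < n.+1%:R by apply: truncnS_gt.
have bern m : 1 + m%:R / 3 <= (4 / 3) ^+ m :> R.
  elim: m => [|m IH]; first by rewrite mul0r addr0 expr0.
  rewrite exprS -natr1; have : 0 <= m%:R :> R by []; nra.
have := bern n.+1; have := Kn n.+1; lra.
Qed.

Lemma uact_adjoint (u : unitization (adjointable E)) x y :
  inner (uact (fun (t : adjointable E) (z : E) => t z) u x) y =
  inner x (uact (fun (t : adjointable E) (z : E) => t z) (ustar u) y).
Proof. by rewrite /uact innerDl innerZl innerDr innerZr adjointP. Qed.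

(** The C*-inequality is Cauchy-Schwarz for <w,w> = <v, u^* w> with w = u v. For completeness, the
    operators and their adjoints both converge uniformly on bounded sets, and the two limits are
    adjoint to each other. *)
Lemma adjointable_cstar_action :
  cstar_action (fun (t : adjointable E) (x : E) => t x).
Proof.
pose act (t : adjointable E) (x : E) := t x; rewrite -/act.
(* A bound passes to the adjoint: |t^* x|^2 = |<x, t t^* x>| <= |x| e |t^* x|. *)
have adj_le t e x : 0 <= e -> (forall z, rnorm (t z) <= e * rnorm z) ->
    rnorm (adjoint t x) <= e * rnorm x.
  move=> e0 te.
  have [a0|a0] := eqVneq (rnorm (adjoint t x)) 0.
    by rewrite a0 mulr_ge0 ?rnorm_ge0.
  have ap : 0 < rnorm (adjoint t x) by rewrite lt_def a0 rnorm_ge0.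
  rewrite -(ler_pM2r ap) -expr2 rnorm_hilbert adjoint_inner.
  rewrite (le_trans (cauchy_schwarz _ _)) // mulrC mulrAC ler_wpM2r ?rnorm_ge0 //.
split=> //.
- by move=> t k v w; apply: adjointable_linear.
- exact: adjointable_bounded.
- by move=> t t0; apply: adjointable_ext.
- move=> u v; set w := uact act u v; rewrite rnorm_hilbert.
  rewrite [inner w w]uact_adjoint; by rewrite (le_trans (cauchy_schwarz _ _)) // mulrC.
move=> s cs.
have lim (f : nat -> adjointable E) :
    (forall e : R, 0 < e -> exists N, forall m n, (N <= m)%N -> (N <= n)%N ->
       forall v, rnorm (act (f m - f n) v) <= e * rnorm v) ->
    exists T : E -> E, forall e : R, 0 < e -> exists N, forall n, (N <= n)%N ->
       forall v, rnorm (act (f n) v - T v) <= e * rnorm v.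
  move=> cf.
  have pt v : exists l, forall e : R, 0 < e -> exists N, forall n, (N <= n)%N ->
     rnorm (act (f n) v - l) <= e.
    apply: rnorm_complete => e e0.
    have v1 : 0 < rnorm v + 1 by rewrite ltr_wpDl ?rnorm_ge0.
    have ev0 : 0 < e / (rnorm v + 1) by rewrite divr_gt0.
    have [N NP] := cf _ ev0; exists N => m n Nm Nn.
    rewrite (le_trans (NP m n Nm Nn v)) // mulrAC ler_pdivrMr //.
    by rewrite ler_pM2l // lerDl.
  have [T TP] := choice pt; exists T => e e0.
  have [N NP] := cf e e0; exists N => n Nn v.
  apply/ler_addgt0Pr => e' e'0; have [M MP] := TP v e' e'0.
  have -> : act (f n) v - T v = act (f n - f (maxn N M)) v + (act (f (maxn N M)) v - T v).
    by rewrite addrA subrK.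
  rewrite (le_trans (rnormD _ _)) // lerD ?MP ?leq_maxr //.
  by rewrite NP // leq_maxl.
have [T TP] := lim s cs.
have [|T' TP'] := lim (fun n => adjoint (s n)).
  move=> e e0; have [N NP] := cs e e0; exists N => m n Nm Nn v.
  rewrite -(starB (s m) (s n)).
  by apply: adj_le; [exact: ltW|exact: NP].
have TT' : is_adjoint T T'.
  move=> x y; apply/eqP; rewrite -subr_eq0; apply/eqP/rnorm_eq0/eqP.
  rewrite eq_le rnorm_ge0 andbT; apply/ler_addgt0Pr => e e0; rewrite add0r.
  pose k := rnorm x * rnorm y + 1.
  have xy0 : 0 <= rnorm x * rnorm y by rewrite mulr_ge0 ?rnorm_ge0.
  have k0 : 0 < k by rewrite ltr_wpDl.
  have ek0 : 0 < e / 2 / k by rewrite !divr_gt0.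
  have [N NP] := TP _ ek0; have [M MP] := TP' _ ek0.
  set n := maxn N M.
  have -> : inner (T x) y - inner x (T' y) =
      - inner (act (s n) x - T x) y + inner x (act (adjoint (s n)) y - T' y).
    by rewrite innerBl innerBr -adjointP opprB addrA subrK.
  have ke : e / 2 / k * (rnorm x * rnorm y) <= e / 2.
    rewrite mulrAC ler_pdivrMr // ler_pM2l ?divr_gt0 // lerDl //.
  rewrite (splitr e) (le_trans (rnormD _ _)) // rnormN lerD //.
    rewrite (le_trans (cauchy_schwarz _ _)) // (le_trans _ ke) // mulrA.
    by rewrite ler_wpM2r ?rnorm_ge0 // NP // leq_maxl.
  rewrite (le_trans (cauchy_schwarz _ _)) // (le_trans _ ke) // mulrCA.
  by rewrite ler_wpM2l ?rnorm_ge0 // MP // leq_maxr.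
have Tadj : T \in adjointable_pred by apply/asboolP; exists T'.
exists (Adjointable Tadj) => e e0; have [N NP] := TP e e0.
by exists N => n Nn v; apply: NP.
Qed.

End HilbertAction.

(** * Real functional calculus and the inequalities *)

Section RealCalculus.
Context {R : realType} {S : starAlgType R} {nrm : unitization S -> R}.
Hypothesis H : ucstar (@ustar R S) nrm.
Context (a : S) (pa : positive a).
Implicit Types (f g h : R -> R).

Definition real_lift g (z : R[i]) : R[i] := (g (complex.Re z))%:C.

Lemma calculus_fun_real_lift g : continuous g -> g 0 = 0 ->
  calculus_fun a (real_lift g).
Proof.
move=> cg g0; split; first by rewrite /real_lift /= g0.
apply: continuous_subspaceT => x.
apply/(@cvgrPdist_le R[i] R[i]^o _ (nbhs (x : R[i]^o))) => e e0.
have eE : e = (complex.Re e)%:C by apply/ge0_ReK/ltW.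
have e0' : 0 < complex.Re e by rewrite -ltcR -eE.
have /cvgrPdist_le /(_ _ e0') := cg (complex.Re x).
move=> /nbhs_ballP[d /= d0 dP]; apply/nbhs_ballP.
exists d%:C => /=; first by rewrite ltcR.
move=> y; rewrite /ball /= => xy.
rewrite -rmorphB cabsE cabs_real eE lecR; apply: dP; rewrite /ball /=.
by rewrite -raddfB /= -ltcR (le_lt_trans (normc_ge_Re _)).
Qed.

Lemma calculus_fun_id : calculus_fun a id.
Proof. by split=> //; apply: continuous_subspaceT => x; apply: cvg_id. Qed.

Context (phi : (R[i] -> R[i]) -> S) (phiP : is_functional_calculus a phi).

(* phi only applies to functions vanishing at 0; the value at 0 becomes the
   scalar part in the unitization. *)
Definition rcalc g : unitization S :=
  (phi (real_lift (fun z => g z - g 0)), (g 0)%:C).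

Let lift0 g : continuous g -> calculus_fun a (real_lift (fun z => g z - g 0)).
Proof.
move=> cg; apply: calculus_fun_real_lift; last by rewrite subrr.
by move=> x; apply: (@cvgB R R^o); [exact: cg|exact: cvg_cst].
Qed.

Lemma rcalc_ext f g : continuous f -> continuous g ->
  (forall x : R, spectrum a x%:C -> f x = g x) -> rcalc f = rcalc g.
Proof.
move=> cf cg fg; have f0 : f 0 = g 0 by apply: fg; rewrite spectrumE; apply: sp_emb0.
congr pair; last by rewrite f0.
case: phiP => ext _ _ _ _; apply: ext; [exact: lift0|exact: lift0|].
move=> z az; rewrite /real_lift f0 fg // -ge0_ReK //.
exact: (proj2 pa).
Qed.

Lemma rcalcD f g : continuous f -> continuous g ->
  rcalc (fun z => f z + g z) = rcalc f + rcalc g.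
Proof.
move=> cf cg; congr pair; last by rewrite /= rmorphD.
case: phiP => _ DM _ _ _; have [<- _] := DM _ _ (lift0 cf) (lift0 cg).
congr phi; apply/funext => z; rewrite /real_lift -rmorphD /=.
by congr (_%:C); rewrite opprD addrACA.
Qed.

Lemma rcalcZ (k : R) f : continuous f ->
  rcalc (fun z => k * f z) = k%:C *: rcalc f.
Proof.
move=> cf; congr pair; last by rewrite /= rmorphM.
case: phiP => _ _ Z _ _; rewrite -[RHS](Z _ _ (lift0 cf)).
congr phi; apply/funext => z; rewrite /real_lift -rmorphM /=.
by rewrite mulrBr.
Qed.

Lemma rcalc_cst (k : R) : rcalc (cst k) = k%:C%:A.
Proof.
rewrite uscaleE; congr pair; case: phiP => ext _ Z _ phiid.
transitivity (phi (fun z => 0 * z)); last by rewrite (Z 0 id calculus_fun_id) scale0r.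
by congr phi; apply/funext => z; rewrite /real_lift /= subrr mul0r.
Qed.

Lemma rcalcM f g : continuous f -> continuous g ->
  rcalc (fun z => f z * g z) = rcalc f * rcalc g.
Proof.
move=> cf cg; congr pair; last by rewrite /= rmorphM.
pose f0 z := f z - f 0; pose g0 z := g z - g 0.
have cf0 : continuous f0 by move=> x; apply: (@cvgB R R^o); [exact: cf|exact: cvg_cst].
have cg0 : continuous g0 by move=> x; apply: (@cvgB R R^o); [exact: cg|exact: cvg_cst].
have cfg : continuous (fun z => f0 z * g0 z).
  by move=> x; apply: cvgM; [exact: cf0|exact: cg0].
have cZ (k : R) h : continuous h -> continuous (fun z => k * h z).
  by move=> ch x; apply: cvgM; [exact: cvg_cst|exact: ch].
have cD h h' : continuous h -> continuous h' -> continuous (fun z => h z + h' z).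
  by move=> ch ch' x; apply: (@cvgD R R^o); [exact: ch|exact: ch'].
have f00 : f0 0 = 0 by rewrite /f0 subrr.
have g00 : g0 0 = 0 by rewrite /g0 subrr.
have lift h : continuous h -> h 0 = 0 -> calculus_fun a (real_lift h).
  exact: calculus_fun_real_lift.
case: phiP => _ DM Z _ _.
have lf := lift _ cf0 f00; have lg := lift _ cg0 g00.
have lfg : calculus_fun a (real_lift (fun z => f0 z * g0 z)).
  by apply: lift => //; rewrite f00 mul0r.
have lZ (k : R) h : continuous h -> h 0 = 0 -> calculus_fun a (real_lift (fun z => k * h z)).
  by move=> ch h0; apply: lift; [exact: cZ|rewrite h0 mulr0].
have l1 := lZ (f 0) g0 cg0 g00; have l2 := lZ (g 0) f0 cf0 f00.
have l3 : calculus_fun a (real_lift (fun z => f0 z * g0 z + f 0 * g0 z)).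
  by apply: lift; [apply: cD => //; apply: cZ|rewrite f00 g00 mul0r mulr0 addr0].
have liftD h h' : real_lift (fun z => h z + h' z) =
    fun z => real_lift h z + real_lift h' z.
  by apply/funext => z; rewrite /real_lift rmorphD.
have liftM h h' : real_lift (fun z => h z * h' z) =
    fun z => real_lift h z * real_lift h' z.
  by apply/funext => z; rewrite /real_lift rmorphM.
have liftZ (k : R) h : real_lift (fun z => k * h z) = fun z => k%:C * real_lift h z.
  by apply/funext => z; rewrite /real_lift rmorphM.
have phiZ (k : R) h : continuous h -> h 0 = 0 ->
    phi (real_lift (fun z => k * h z)) = k%:C *: phi (real_lift h).
  by move=> ch h0; rewrite liftZ; exact: (Z _ _ (lift _ ch h0)).
(* fg - f(0)g(0) = f0 g0 + f(0) g0 + g(0) f0 mirrors the first component of a product in the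
   unitization. *)
transitivity (phi (real_lift (fun z => f0 z * g0 z + f 0 * g0 z + g 0 * f0 z))).
  congr phi; congr real_lift; apply/funext => z.
  by rewrite /f0 /g0; ring.
rewrite liftD (DM _ _ l3 l2).1 liftD (DM _ _ lfg l1).1 liftM (DM _ _ lf lg).2.
by rewrite !phiZ.
Qed.

Lemma rcalc_star f : continuous f -> ustar (rcalc f) = rcalc f.
Proof.
move=> cf; congr pair; last by rewrite /= conj_realC.
case: phiP => _ _ _ J _; rewrite /= -[LHS]J; last exact: lift0.
by congr phi; apply/funext => z; rewrite /real_lift conj_realC.
Qed.

Lemma rcalc_emb f : f 0 = 0 ->
  rcalc f = uemb (phi (real_lift f)).
Proof.
move=> f0; rewrite /rcalc f0; congr pair; congr phi.
by congr real_lift; apply/funext => z; rewrite subr0.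
Qed.

Lemma rcalc_id : rcalc id = uemb a.
Proof.
rewrite rcalc_emb //; congr uemb; case: phiP => ext _ _ _ phiid.
rewrite -[RHS]phiid; apply: ext.
- by apply: calculus_fun_real_lift => // x; apply: cvg_id.
- exact: calculus_fun_id.
- by move=> z az; rewrite /real_lift -ge0_ReK //; apply: (proj2 pa).
Qed.

(** The root is kept explicit because, for t in L(E), it gives <f(t)x,x> = <sx,sx>. [Num.sqrt] is 0
    on negative reals, so the root is continuous everywhere while the sign of f matters only on the
    spectrum. *)
Lemma rcalc_sqrt f : continuous f -> (forall x : R, spectrum a x%:C -> 0 <= f x) ->
  exists s, ustar s = s /\ rcalc f = s * s.
Proof.
move=> cf f0; have cs : continuous (fun z => Num.sqrt (f z)).
  by move=> x; apply: (@continuous_comp _ _ _ f Num.sqrt);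
    [exact: cf|exact: sqrt_continuous].
exists (rcalc (fun z => Num.sqrt (f z))); rewrite rcalc_star // -rcalcM //.
split=> //; apply: rcalc_ext => //.
  by move=> x; apply: cvgM; exact: cs.
by move=> x /f0 fx; rewrite -expr2 sqr_sqrtr.
Qed.

Lemma rcalc_upos f : continuous f -> (forall x : R, spectrum a x%:C -> 0 <= f x) ->
  upos ustar (rcalc f).
Proof. by move=> cf /(rcalc_sqrt cf)[s [ss ->]]; apply: upos_sq H _ ss. Qed.

Lemma spectrum_bound (x : R) : spectrum a x%:C -> 0 <= x <= nrm (uemb a).
Proof.
move=> ax; have := proj2 pa _ ax; rewrite /= ler0c => x0; rewrite x0 /=.
by move: ax; rewrite spectrumE => /(sp_norm H); rewrite cabs_real ger0_norm.
Qed.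

(* Hat functions h i = psi i - psi i.+1 of width d form a partition of unity on
   the spectrum, which glues the local lower bounds g of y into f. *)
Lemma rcalc_glue f (y : unitization S) :
  (forall u v : unitization S, u * v = v * u) -> continuous f ->
  (forall e : R, 0 < e -> exists2 d : R, 0 < d & forall s : R, 0 <= s ->
     exists g, [/\ continuous g, upos ustar (y - rcalc g) &
       forall z : R, spectrum a z%:C -> `|z - s| <= d -> f z - e <= g z]) ->
  upos ustar (y - rcalc f).
Proof.
move=> comm cf loc.
have sy : ustar y = y.
  have [d d0 /(_ 0 (lexx _))[g [cg [sg _] _]]] := loc 1 ltr01.
  by rewrite -[y](subrK (rcalc g)) (uc_starD H) sg rcalc_star.
apply: (upos_adde H) => [|e e0]; first by rewrite (uc_starB H) sy rcalc_star.
have [d d0 dP] := loc e e0.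
have [g gP] := choice (fun i : nat => dP (i%:R * d) (mulr_ge0 (ler0n R i) (ltW d0))).
(* Large enough for [psi K] to vanish on the spectrum. *)
pose K := (Num.truncn (nrm (uemb a) / d + 1)).+1.
(* [psi i] rises from 0 at (i-1)d to 1 at id, so [h i] is the hat centred at id. *)
pose psi (i : nat) (z : R) : R := Num.min 1 (Num.max 0 (z / d - i%:R + 1)).
have cpsi i : continuous (psi i).
  move=> x; pose v z : R := z / d - i%:R + 1.
  apply: (@continuous_min R R (cst 1) (fun z => Num.max 0 (v z)) x).
    exact: cvg_cst.
  apply: (@continuous_max R R (cst 0) v x); first exact: cvg_cst.
  apply: (@cvgD R R^o); last exact: cvg_cst.
  apply: (@cvgB R R^o); last exact: cvg_cst.
  by apply: cvgM; [exact: cvg_id|exact: cvg_cst].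
pose h i z := psi i z - psi i.+1 z.
have ch i : continuous (h i) by move=> x; apply: (@cvgB R R^o); exact: cpsi.
have h_ge0 i z : 0 <= h i z.
  rewrite subr_ge0 /psi le_min ge_min lexx /= ge_min; apply/orP; right.
  rewrite ge_max le_max lexx /= le_max; apply/orP; right.
  by rewrite lerD2r lerD2l lerN2 ler_nat.
have h_supp i z : h i z != 0 -> `|z - i%:R * d| <= d.
  move=> hz; have -> : z - i%:R * d = (z / d - i%:R) * d by field; rewrite gt_eqF.
  rewrite normrM (gtr0_norm d0) ler_piMl ?(ltW d0) // ler_norml.
  set w := z / d - i%:R; apply/andP; split; rewrite leNgt; apply/negP => w1.
    move/negP: hz; apply; rewrite /h /psi -natr1 opprD addrA -/w.
    rewrite (max_l (_ : w + 1 <= 0)); last by lra.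
    rewrite (max_l (_ : w - 1 + 1 <= 0)); last by lra.
    by rewrite subrr.
  move/negP: hz; apply; rewrite /h /psi -natr1 opprD addrA -/w.
  rewrite (max_r (_ : 0 <= w + 1)); last by lra.
  rewrite (max_r (_ : 0 <= w - 1 + 1)); last by lra.
  rewrite (min_l (_ : 1 <= w + 1)); last by lra.
  rewrite (min_l (_ : 1 <= w - 1 + 1)); last by lra.
  by rewrite subrr.
have sum_h : \sum_(i < K) rcalc (h i) = 1.
  have hE i : rcalc (h i) = rcalc (psi i) - rcalc (psi i.+1).
    rewrite -[- rcalc _]scaleN1r -(rmorph1 (real_complex R)) -rmorphN -rcalcZ //.
    rewrite -rcalcD //; last first.
      by move=> x; apply: cvgM; [exact: cvg_cst|exact: cpsi].
    by congr rcalc; apply/funext => z; rewrite mulN1r.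
  transitivity (- \sum_(0 <= i < K) (rcalc (psi i.+1) - rcalc (psi i))).
    by rewrite big_mkord -sumrN; apply: eq_bigr => i _; rewrite hE opprB.
  rewrite telescope_sumr // opprB.
  have -> : rcalc (psi 0%N) = 1.
    rewrite -[RHS]scale1r -(rmorph1 (real_complex R)) -rcalc_cst.
    apply: rcalc_ext => // [x|x /spectrum_bound/andP[x0 _]]; first exact: cvg_cst.
    have xd : 0 <= x / d by rewrite divr_ge0 // ltW.
    rewrite /psi subr0 (max_r (_ : 0 <= _)); last by lra.
    by rewrite min_l //; lra.
  have -> : rcalc (psi K) = 0.
    rewrite -[RHS](scale0r 1) -(rmorph0 (real_complex R)) -rcalc_cst.
    apply: rcalc_ext => // [x|x /spectrum_bound/andP[_ xM]]; first exact: cvg_cst.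
    have : nrm (uemb a) / d + 1 < K%:R by apply: truncnS_gt.
    have xd : x / d <= nrm (uemb a) / d by rewrite ler_pM2r // invr_gt0.
    move=> Kd; rewrite /psi (max_l (_ : _ <= 0)); last by lra.
    by rewrite min_r.
  by rewrite subr0.
(* Insert 1 = sum of the h i, and g i in each term: the first summand is a product of commuting
   positive elements, the second is nonnegative where h i is nonzero, by the local bound. *)
have -> : y - rcalc f + e%:C%:A = \sum_(i < K) (rcalc (h i) * (y - rcalc (g i)) +
    rcalc (fun z => h i z * (g i z - f z + e))).
  rewrite -[LHS]mul1r -{1}sum_h mulr_suml; apply: eq_bigr => i _.
  have [cg _ _] := gP i.
  have cNf : continuous (fun z => - 1 * f z).
    by move=> x; apply: cvgM; [exact: cvg_cst|exact: cf].
  have cgf : continuous (fun z => g i z + - 1 * f z).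
    by move=> x; apply: (@cvgD R R^o); [exact: cg|exact: cNf].
  have -> : (fun z => h i z * (g i z - f z + e)) =
      (fun z => h i z * (g i z + - 1 * f z + cst e z)).
    by apply/funext => z; rewrite mulN1r.
  rewrite rcalcM //; last first.
    by move=> x; apply: (@cvgD R R^o); [exact: cgf|exact: cvg_cst].
  rewrite rcalcD //; last by move=> x; apply: cvg_cst.
  rewrite rcalcD // rcalcZ // rcalc_cst rmorphN rmorph1 scaleN1r -mulrDr.
  by congr (_ * _); rewrite !addrA subrK.
apply: (upos_sum H) => i _; have [cg yg fg] := gP i.
apply: (uposD H).
  by apply: (uposM H); [exact: rcalc_upos|exact: yg|exact: comm].
apply: rcalc_upos => [x|x ax].
  apply: cvgM; first exact: ch.
  apply: (@cvgD R R^o); last exact: cvg_cst.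
  by apply: (@cvgB R R^o); [exact: cg|exact: cf].
have [->|hx] := eqVneq (h i x) 0; first by rewrite mul0r.
by rewrite mulr_ge0 //; have := fg x ax (h_supp _ _ hx); lra.
Qed.

End RealCalculus.

(** * Real powers and their tangent lines *)

Section PowerInequalities.
Context {R : realType}.
Implicit Types (r z m : R).

(* powR is the constant 1 on negative reals, hence the truncation. *)
Definition pospow r z : R := Num.max z 0 `^ r.

Lemma pospowE r z : 0 <= z -> pospow r z = z `^ r.
Proof. by move=> z0; rewrite /pospow max_l. Qed.

Lemma continuous_pospow r : 0 < r -> continuous (pospow r).
Proof.
move=> r0 z; have [z0|z0] := ltP 0 z.
  have cmax : {for z, continuous (fun y : R => Num.max y 0)}.
    by apply: (@continuous_max R R id (cst 0) z); [exact: cvg_id|exact: cvg_cst].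
  apply: (@continuous_comp _ _ _ (fun y : R => Num.max y 0) (fun y => y `^ r)) => //.
  apply/differentiable_continuous/derivable1_diffP/derivable_powR.
  by rewrite max_l ?(ltW z0) // in_itv /= z0.
apply/cvgrPdist_le => e e0; have d0 : 0 < e `^ r^-1 by apply: powR_gt0.
apply/nbhs_ballP; exists (e `^ r^-1) => // y; rewrite /ball /= => yz.
rewrite {1}/pospow max_r // powR0 ?gt_eqF // sub0r normrN ger0_norm ?powR_ge0 //.
have ye : Num.max y 0 <= e `^ r^-1.
  rewrite ge_max (ltW d0) andbT.
  have := ler_norm (y - z); rewrite distrC => /le_lt_trans /(_ yz); lra.
have -> : e = (e `^ r^-1) `^ r.
  by rewrite -powRrM mulVf ?gt_eqF // powRr1 // ltW.
by apply: ge0_ler_powR; rewrite ?nnegrE ?(ltW r0) ?(ltW d0) // le_max lexx orbT.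
Qed.

Lemma pospow_uniform r (M : R) : 0 < r -> forall e : R, 0 < e ->
  exists2 d : R, 0 < d & forall z w : R, 0 <= z <= M -> 0 <= w <= M ->
    `|w - z| < d -> `|pospow r w - pospow r z| <= e.
Proof.
move=> r0 e e0; have pc : pointwise_continuous `[0, M]%classic (fun z => (pospow r z)%:C).
  move=> z _ e' e'0.
  have /cvgrPdist_le /(_ _ e'0) /nbhs_ballP[d /= d0 dP] := @continuous_pospow r r0 z.
  exists d => // y _ yz; rewrite -rmorphB cabs_real distrC; apply: dP.
  by rewrite /ball /= distrC.
have [d d0 dP] := compact_uniform (@segment_compact R 0 M) pc e0.
exists d => // z w zM wM zw; have := dP z w; rewrite /= !in_itv /= => /(_ zM wM zw).
by rewrite -rmorphB cabs_real.
Qed.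

(** Young's inequality for z and m^(r-1), with exponents r and r/(r-1), multiplied by r. *)
Lemma tangent_le r z m : 1 < r -> 0 <= z -> 0 <= m ->
  r * m `^ (r - 1) * z <= z `^ r + (r - 1) * m `^ r.
Proof.
move=> r1 z0 m0; have r0 : 0 < r by lra.
have q0 : 0 < r / (r - 1) by rewrite divr_gt0 // subr_gt0.
have pq : r^-1 + (r / (r - 1))^-1 = 1 by field; lra.
have := conjugate_powR z0 (powR_ge0 m (r - 1)) r0 q0 pq.
rewrite -powRrM (_ : (r - 1) * (r / (r - 1)) = r); last by field; lra.
rewrite -(ler_pM2l r0) (_ : r * (_ / r + _) = z `^ r + (r - 1) * m `^ r).
  by rewrite -mulrA [z * _]mulrC.
by field; lra.
Qed.

(** Young's inequality with exponents 1/r and 1/(1-r) for z^r m^(r(r-1)) and m^(r(1-r)), whose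
    product is z^r because m > 0. *)
Lemma tangent_ge r z m : 0 < r -> r < 1 -> 0 <= z -> 0 < m ->
  z `^ r <= r * m `^ (r - 1) * z + (1 - r) * m `^ r.
Proof.
move=> r0 r1 z0 m0; have m0' := ltW m0; have mN : m != 0 by rewrite gt_eqF.
have p0 : 0 < r^-1 by rewrite invr_gt0.
have q0 : 0 < (1 - r)^-1 by rewrite invr_gt0 subr_gt0.
have pq : r^-1^-1 + (1 - r)^-1^-1 = 1 by rewrite !invrK addrC subrK.
have := conjugate_powR (mulr_ge0 (powR_ge0 z r) (powR_ge0 m (r * (r - 1))))
  (powR_ge0 m (r * (1 - r))) p0 q0 pq.
rewrite !invrK powRM ?powR_ge0 // -!powRrM -(mulrA (z `^ r)) -powRD ?mN ?implybT //.
rewrite (_ : r * (r - 1) + r * (1 - r) = 0); last by ring.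
rewrite powRr0 mulr1 mulfV ?gt_eqF // powRr1 //.
rewrite (_ : r * (r - 1) * r^-1 = r - 1); last by field; lra.
rewrite (_ : r * (1 - r) * (1 - r)^-1 = r); last by field; lra.
by move=> /le_trans; apply; rewrite le_eqVlt; apply/orP; left; apply/eqP; ring.
Qed.

Lemma tangent_lower r (M : R) : 1 < r -> forall e : R, 0 < e ->
  exists2 d : R, 0 < d & forall s, 0 <= s -> exists2 l, 0 <= l &
  forall z, 0 <= z <= M -> `|z - s| <= d ->
    pospow r z - e <= r * l `^ (r - 1) * z - (r - 1) * l `^ r.
Proof.
move=> r1 e e0; have r0 : 0 < r by lra.
have [d d0 dP] := @pospow_uniform r M r0 e e0.
exists (d / 3); first by rewrite divr_gt0.
move=> s s0; exists (Num.max 0 (s - d / 3)); first by rewrite le_max lexx.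
set l := Num.max _ _ => z /andP[z0 zM]; rewrite ler_norml => /andP[sz zs].
have l0 : 0 <= l by rewrite le_max lexx.
have sl : s - d / 3 <= l by rewrite le_max lexx orbT.
have lz : l <= z by rewrite ge_max z0 /=; lra.
have zl : `|l - z| < d by rewrite ltr_norml; apply/andP; split; lra.
have := dP z l; rewrite z0 zM l0 (le_trans lz zM) => /(_ isT isT zl).
rewrite ler_norml => /andP[+ _]; rewrite (pospowE _ l0) => lzr.
apply: (@le_trans _ _ (l `^ r)); first by lra.
rewrite -(mulr_powRB1 l0 r0) [l * _]mulrC.
have := powR_ge0 l (r - 1); set k := l `^ (r - 1) => k0.
rewrite (_ : _ - _ = k * l + r * k * (z - l)); last by ring.
by rewrite lerDl !mulr_ge0 ?subr_ge0 // ltW.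
Qed.

(** Here l = s + d lies to the right of z, so the slope term can again be dropped, and l is
    positive, away from the infinite slope at 0. The interval up to M + 2 makes room for l <= z + 2d
    with d <= 1. *)
Lemma tangent_upper r (M : R) : 0 < r -> r < 1 -> forall e : R, 0 < e ->
  exists2 d : R, 0 < d & forall s, 0 <= s -> exists2 l, 0 < l &
  forall z, 0 <= z <= M -> `|z - s| <= d ->
    r * l `^ (r - 1) * z + (1 - r) * l `^ r <= pospow r z + e.
Proof.
move=> r0 r1 e e0.
have [d0 d00 dP] := @pospow_uniform r (M + 2) r0 e e0.
pose d := Num.min 1 (d0 / 3); have dgt0 : 0 < d by rewrite lt_min ltr01 divr_gt0.
have d1 : d <= 1 by rewrite ge_min lexx.
have d3 : d <= d0 / 3 by rewrite ge_min lexx orbT.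
exists d => // s s0; exists (s + d); first by lra.
move=> z /andP[z0 zM]; rewrite ler_norml => /andP[sz zs].
set l := s + d; have l0 : 0 < l by rewrite /l; lra.
have lE : l = s + d by [].
have zl : `|l - z| < d0 by rewrite ltr_norml; apply/andP; split; lra.
have zM' : 0 <= z <= M + 2 by rewrite z0 /=; lra.
have lM : 0 <= l <= M + 2 by apply/andP; split; lra.
have := dP z l zM' lM zl; rewrite ler_norml => /andP[_].
rewrite (pospowE _ (ltW l0)) => lzr.
apply: (@le_trans _ _ (l `^ r)); last by lra.
rewrite -(mulr_powRB1 (ltW l0) r0) [l * _]mulrC.
have := powR_ge0 l (r - 1); set k := l `^ (r - 1) => k0.
rewrite (_ : _ + _ = k * l - r * k * (l - z)); last by ring.
rewrite gerBl !mulr_ge0 ?(ltW r0) // subr_ge0; lra.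
Qed.

End PowerInequalities.

(** [apow] is built on [powR], which is 1 on negative reals; agreement with [pospow r] on the
    spectrum transfers continuity there. *)
Lemma apowE (R : realType) (S : starAlgType R) (nrm : unitization S -> R)
    (H : ucstar (@ustar R S) nrm) (a : S) (r : R) : positive a -> 0 < r ->
  rcalc (functional_calculus a) (pospow r) = uemb (apow a r).
Proof.
move=> pa r0; have pr0 : pospow r 0 = 0 by rewrite pospowE // powR0 // gt_eqF.
have cl := calculus_fun_real_lift a (continuous_pospow r0) pr0.
have powE z : spectrum a z -> real_lift (pospow r) z = (complex.Re z `^ r)%:C.
  move=> /(proj2 pa) /= z0; rewrite /real_lift pospowE //.
  by rewrite -ler0c -ge0_ReK.
rewrite rcalc_emb //; congr uemb.
rewrite /apow; move: (functional_calculus a) (functional_calculusP H pa) => phi.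
case=> ext _ _ _ _; apply: ext; [exact: cl| |exact: powE].
split; first by rewrite powR0 // gt_eqF.
apply: subspace_eq_continuous (proj2 cl) => z; rewrite inE => az.
exact: powE.
Qed.

(** * From scalar tangent lines to the inequality for operators *)

Section Jensen.
Context {R : realType} {A : cstarAlgType R} (comA : commutative (@amul R A)).
Context {E : hilbertModType A} (t : adjointable E) (x : E).
Hypotheses (pt : positive t) (x0 : x != 0).

Let act (s : adjointable E) (y : E) : E := s y.
Let HA := @cnorm_ucstar R A.
Let HT : ucstar (@ustar R (adjointable E)) (unorm act) :=
  unorm_ucstar (adjointable_cstar_action comA (E := E)).
Let comU := @umul_comm R A comA.
Let phi := functional_calculus t.
Let phiP : is_functional_calculus t phi := functional_calculusP HT pt.
Let b := inner (t x) x.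
Let n := inner x x.
Let N := rnorm n.

Let N_gt0 : 0 < N.
Proof.
rewrite lt_def rnorm_ge0 andbT; apply/eqP => /rnorm_eq0/inner_eq0/eqP.
by rewrite (negbTE x0).
Qed.

(** f(t) = s s with s self-adjoint, so the element is <sx,sx>. Applied to z^r minus a tangent line,
    up to sign, it carries the scalar inequality to E. *)
Lemma inner_rcalc_ge0 (f : R -> R) : continuous f ->
  (forall z : R, spectrum t z%:C -> 0 <= f z) ->
  positive (inner (uact act (rcalc phi f) x) x).
Proof.
move=> cf /(rcalc_sqrt pt phiP cf)[s [ss ->]].
rewrite (uactM (adjointable_cstar_action comA (E := E))) uact_adjoint ss.
exact: inner_ge0.
Qed.

Lemma inner_positive : positive b.
Proof.
have -> : b = inner (uact act (rcalc phi id) x) x.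
  by rewrite (rcalc_id pt phiP) /uact /= scale0r addr0.
apply: inner_rcalc_ge0 => [z|z /(proj2 pt)]; first exact: cvg_id.
by rewrite /= ler0c.
Qed.

(* The sign sg is 1 in the convex case and -1 in the concave one. Commutativity
   enters through rcalc_glue, which replaces the supremum of the scalar tangent
   bounds over l by the power of b. *)
Lemma jensen_pow (r sg : R) : 0 < r -> 0 <= sg * (r - 1) ->
  (forall M e : R, 0 < e -> exists2 d : R, 0 < d &
    forall s : R, 0 <= s -> exists l : R, [/\ 0 <= l,
      forall z : R, 0 <= z -> 0 <= sg * (z `^ r -
        r * (l / N) `^ (r - 1) * z + (r - 1) * (l / N) `^ r) &
      forall z : R, 0 <= z <= M -> `|z - s| <= d ->
        sg * pospow r z - e <= sg * (r * l `^ (r - 1) * z - (r - 1) * l `^ r)]) ->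
  positive (sg%:C *: ((rnorm x `^ (2 * (r - 1)))%:C *: inner (apow t r x) x
                      - apow b r)).
Proof.
move=> r0 sgr loc; have cpow := continuous_pospow r0.
have pb := inner_positive.
have phibP := functional_calculusP HA pb.
have cZ (k : R) h : continuous h -> continuous (fun z : R => k * h z).
  by move=> ch z; apply: cvgM; [exact: cvg_cst|exact: ch].
have cD (h h' : R -> R) : continuous h -> continuous h' -> continuous (fun z => h z + h' z).
  by move=> ch ch' z; apply: (@cvgD R R^o); [exact: ch|exact: ch'].
have cid : continuous (id : R -> R) by move=> z; apply: cvg_id.
have cc (k : R) : continuous (cst k : R -> R) by move=> z; apply: cvg_cst.
set c := inner (apow t r x) x.
have -> : rnorm x `^ (2 * (r - 1)) = N `^ (r - 1).
  by rewrite powRrM powR_mulrn ?rnorm_ge0 // rnorm_hilbert.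
set k := N `^ (r - 1).
have k0 : 0 <= k by apply: powR_ge0.
rewrite (positiveE _) uembZ uembB scalerBr -(apowE HA pb r0) -(rcalcZ phibP) //.
apply: (rcalc_glue HA pb phibP comU) => [|e e0]; first exact: cZ.
have [d d0 dP] := loc (cnorm (uemb b)) e e0; exists d => // s s0.
have [l [l0 tan lP]] := dP s s0.
(* k1 z + k2 is sg times the tangent line of z^r at l. *)
pose k1 := sg * r * l `^ (r - 1); pose k2 := - (sg * (r - 1) * l `^ r).
exists (fun z => k1 * id z + cst k2 z); split; first by apply: cD => //; apply: cZ.
  rewrite (rcalcD phibP) //; last exact: cZ.
  rewrite (rcalcZ phibP) // (rcalc_id pb phibP) (rcalc_cst phibP).
  set m := l / N; have m0 : 0 <= m by rewrite divr_ge0 // ltW.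
  pose m1 := - (sg * r * m `^ (r - 1)); pose m2 := sg * (r - 1) * m `^ r.
  have lE : N * m = l by rewrite mulrC divfK // gt_eqF.
  have km1 : k * m1 = - k1.
    by rewrite /k1 -lE powRM ?(ltW N_gt0) // /m1 /k; ring.
  pose k3 := sg * (r - 1) * l `^ r / N.
  have km2 : k * m2 = k3.
    rewrite /k3 -lE powRM ?(ltW N_gt0) // -(mulr_powRB1 (ltW N_gt0) r0) /m2 -/k.
    by field; rewrite gt_eqF.
  have k3N : k3 * N = - k2 by rewrite /k2 opprK divfK // gt_eqF.
  have q_pos : positive (sg%:C *: c + (m1%:C *: b + m2%:C *: n)).
    have := @inner_rcalc_ge0 (fun z => sg * pospow r z + (m1 * id z + cst m2 z)).
    rewrite (rcalcD phiP); [|exact: cZ|by apply: cD => //; apply: cZ].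
    rewrite (rcalcD phiP) //; last exact: cZ.
    rewrite (rcalcZ phiP sg cpow) (rcalcZ phiP m1 cid) (rcalc_id pt phiP) (rcalc_cst phiP).
    rewrite (apowE HT pt r0) !(uactDl (adjointable_cstar_action comA (E := E))).
    rewrite !(uactZl (adjointable_cstar_action comA (E := E))).
    rewrite {1 2}/uact /= !scale0r !addr0.
    have -> : uact act 1 x = x.
      by rewrite /uact /= scale1r /act add0r.
    rewrite !innerDl !innerZl !conj_realC; apply.
      exact: (cD _ _ (cZ sg _ cpow) (cD _ _ (cZ m1 _ cid) (cc m2))).
    move=> z /(proj2 pt); rewrite /= ler0c => z0; have := tan z z0.
    rewrite pospowE // -/m /m1 /m2; congr (0 <= _); ring.
  (* The first term is the tangent inequality for t at m; the second pays for replacing <x,x> by N,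
     and k3 >= 0 is where sg (r - 1) >= 0 enters. *)
  have -> : sg%:C *: uemb (k%:C *: c) - (k1%:C *: uemb b + k2%:C%:A) =
      k%:C *: uemb (sg%:C *: c + (m1%:C *: b + m2%:C *: n)) +
      k3%:C *: (N%:C%:A - uemb n).
    rewrite !(uembD, uembZ) !scalerDr !scalerN !scalerA -!rmorphM km1 km2 k3N.
    rewrite mulrC !rmorphN !scaleNr opprD -!addrA; congr (_ + (_ + _)).
    by rewrite addrCA subrr addr0.
  apply: (uposD HA).
    by apply: (uposZ HA) => //; rewrite -positiveE.
  apply: (uposZ HA); first by rewrite divr_ge0 ?(ltW N_gt0) // mulr_ge0 ?powR_ge0.
  rewrite /N -cnorm_emb; apply: (upos_norm_sub HA).
  by rewrite ustar_emb inner_star.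
move=> z bz zs; have := lP z (spectrum_bound HA pb bz) zs.
by move=> /le_trans; apply; rewrite /k1 /k2 /=; lra.
Qed.

End Jensen.

Theorem theorem4p3 (R : realType) (A : cstarAlgType R)
    (comA : commutative (@amul R A)) (E : hilbertModType A)
    (t : adjointable E) (x : E) :
  positive t -> x != 0 ->
  (forall r : R, 1 < r ->
     ale (apow (inner (t x) x) r)
         ((complex.Re `|x| `^ (2 * (r - 1)))%:C *: inner (apow t r x) x)) /\
  (forall r : R, 0 < r -> r < 1 ->
     ale ((complex.Re `|x| `^ (2 * (r - 1)))%:C *: inner (apow t r x) x)
         (apow (inner (t x) x) r)).
Proof.
move=> pt x0; have N0 : 0 <= rnorm (inner x x) by apply: rnorm_ge0.
split=> r.
  move=> r1; have r0 : 0 < r by lra.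
  have sg : 0 <= 1 * (r - 1) :> R by lra.
  rewrite /ale -[_ - _]scale1r -(rmorph1 (real_complex R)).
  apply: (jensen_pow comA pt x0 r0 sg) => M e e0.
  have [d d0 dP] := @tangent_lower R r M r1 e e0.
  exists d => // s s0; have [l l0 lP] := dP s s0; exists l; split=> // [z z0|z zM zs].
    have := @tangent_le R r z (l / rnorm (inner x x)) r1 z0 (divr_ge0 l0 N0).
    by rewrite mul1r; lra.
  by rewrite !mul1r lP.
(* The concave case is the convex one for -z^r: with the sign -1 the difference is reversed and sg
   (r - 1) becomes 1 - r. *)
move=> r0 r1; have sg : 0 <= -1 * (r - 1) :> R by lra.
rewrite /ale -[_ - _]opprB -scaleN1r -(rmorph1 (real_complex R)) -rmorphN.
apply: (jensen_pow comA pt x0 r0 sg) => M e e0.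
have Np : 0 < rnorm (inner x x).
  rewrite lt_def N0 andbT; apply/eqP => /rnorm_eq0/inner_eq0/eqP.
  by rewrite (negbTE x0).
have [d d0 dP] := @tangent_upper R r M r0 r1 e e0.
exists d => // s s0; have [l l0 lP] := dP s s0.
exists l; split=> [|z z0|z zM zs]; first exact: ltW.
  have := @tangent_ge R r z (l / rnorm (inner x x)) r0 r1 z0 (divr_gt0 l0 Np).
  by rewrite mulN1r; lra.
by have := lP z zM zs; rewrite !mulN1r; lra.
Qed.
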